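(* Let $f,g:\mathbb R^n\to\mathbb R$ be two integrable log-concave functions with full-dimensional supports and continuous when restricted to them. Then $$\int_{\mathbb R^n}\sqrt{f(x)\bar g(x)}\,dx\int_{\mathbb R^n}f\oplus g(x)\,dx\leq 2^n\int_{\mathbb R^n}f(x)\,dx\int_{\mathbb R^n}g(x)\,dx.$$ Equality holds if and only if the following two conditions are satisfied: (i) $\mathrm{supp}\,f=\mathrm{supp}\,\bar g$ is a translation of a cone $C$ with vertex at $0$ with simplicial section, and (ii) $f(x)=c_1e^{-\langle a,x\rangle}$ on $\mathrm{supp}\,f$ and $g(x)=c_2e^{-\langle b,x\rangle}$ on $\mathrm{supp}\,g$ for some $c_1,c_2>0$ and some $a,b\in\mathbb R^n$ such that $\langle a,x\rangle\geq0\geq\langle b,x\rangle$ for every $x\in C$.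
   Context: A function $f:\mathbb R^n\to[0,\infty)$ is log-concave if $f=e^{-u}$ for a convex $u:\mathbb R^n\to(-\infty,\infty]$. $\bar g(x)=g(-x)$. For log-concave $f,g$, $f\oplus g(z):=\sup_{x+y=2z}\sqrt{f(x)g(y)}$. $\mathrm{supp}$ denotes the support of a function. *)

(* Defs.v *)
From HB Require Import structures.
From mathcomp Require Import all_boot all_order all_algebra.
From mathcomp Require Import all_classical all_reals all_analysis.
Set Implicit Arguments. Unset Strict Implicit. Unset Printing Implicit Defensive.
Import Order.TTheory GRing.Theory Num.Theory.
Import numFieldNormedType.Exports.
Local Open Scope classical_set_scope.
Local Open Scope ring_scope.

Definition dotv {R : realType} {n : nat} (x y : 'rV[R]_n) : R :=
  \sum_(i < n) x ord0 i * y ord0 i.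

(* Lebesgue integral over R^n of a nonnegative extended-real valued function,
   written as the iterated integral over the coordinates with respect to
   the Lebesgue measure on R (equal to the Lebesgue integral on R^n for
   nonnegative functions, by Tonelli). *)
Fixpoint iint {R : realType} (n : nat) : ('rV[R]_n -> \bar R) -> \bar R :=
  match n with
  | 0 => fun f => f 0
  | m.+1 => fun f =>
      (\int[@lebesgue_measure R]_t iint (fun v : 'rV[R]_m => f (row_mx (\row_(j < 1) t) v)))%E
  end.

Definition integral_Rn {R : realType} {n : nat} (f : 'rV[R]_n -> R) : \bar R :=
  iint (fun x => (f x)%:E).

(* Convexity of u : R^n -> (-oo, +oo] (convexity of the epigraph). *)
Definition convex_ext {R : realType} {n : nat} (u : 'rV[R]_n -> \bar R) : Prop :=
  forall (x y : 'rV[R]_n) (r s t : R), (u x <= r%:E)%E -> (u y <= s%:E)%E ->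
    0 <= t <= 1 ->
    (u ((1 - t) *: x + t *: y)%R <= ((1 - t) * r + t * s)%:E)%E.

Definition log_concave {R : realType} {n : nat} (f : 'rV[R]_n -> R) : Prop :=
  exists u : 'rV[R]_n -> \bar R,
    (forall x, u x != -oo%E) /\ convex_ext u /\
    forall x, (f x)%:E = expeR (- u x)%E.

Definition supp {R : realType} {n : nat} (f : 'rV[R]_n -> R) : set 'rV[R]_n :=
  closure [set x | f x != 0].

Definition refl {R : realType} {n : nat} (g : 'rV[R]_n -> R) : 'rV[R]_n -> R :=
  fun x => g (- x).

Definition lc_sum {R : realType} {n : nat} (f g : 'rV[R]_n -> R) (z : 'rV[R]_n)
  : \bar R :=
  ereal_sup [set r : \bar R | exists x y : 'rV[R]_n,
                  x + y = 2 *: z /\ r = (Num.sqrt (f x * g y))%:E].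

(* C is a cone with vertex at 0 with simplicial section: the positive hull
   of n linearly independent vectors (the rows of an invertible matrix W). *)
Definition simplicial_cone {R : realType} {n : nat} (C : set 'rV[R]_n) : Prop :=
  exists W : 'M[R]_n, W \in unitmx /\
    C = [set lam *m W | lam in [set lam : 'rV[R]_n | forall i, 0 <= lam ord0 i]].

(* Main.v *)
(* Put k(x) = g(-x), H(z) = int f(u) k(u - z) du and I = int sqrt(f k). If
   x - y = 2z, log-concavity gives
     f((x + x')/2) k((y + x')/2) >= sqrt(f(x) k(y)) sqrt(f(x') k(x')),
   and integrating in x' yields I (f (+) g)(z) <= 2^n H(z); the inequality
   follows by integrating in z, since int H = int f int g.

   In case of equality, semicontinuity and compactness (superlevel sets of
   integrable log-concave functions are bounded) produce for every z in
   int(supp f) - int(supp k) a pair (x, y) for which the pointwise estimate is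
   an equality for all x'. Hence this set is stable under doubling and equals
   R^n. Taking z = 0 shows that int(supp f) meets int(supp k) in q + C with C an
   open cone, and that ln f and ln k are affine on rays from q; for general z,
   int(supp f) meets z + int(supp k) in a translate p + C, on which ln f is a
   constant plus the same function of the cone variable. If supp f were larger
   than q + C, then ln f would be affine along a whole line, contradicting
   integrability. So both supports are the closure of q + C, any two translates
   of C meet in a translate of C, and ln f, ln k are additive on C. A closed
   pointed cone with this intersection property is the positive cone of an
   Archimedean vector lattice of dimension n, hence simplicial. *)
Require Import Defs.
From HB Require Import structures.
From mathcomp Require Import all_boot all_order all_algebra.
From mathcomp Require Import all_classical all_reals all_analysis.
From mathcomp Require Import measurable_realfun ring lra.
Import Order.TTheory GRing.Theory Num.Theory.
Import numFieldNormedType.Exports.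
Local Open Scope classical_set_scope.
Local Open Scope ring_scope.
Set Implicit Arguments. Unset Strict Implicit. Unset Printing Implicit Defensive.

(** * Iterated integrals and measurability *)

(** The equality case starts from an equality of integrals, and two obstacles shape it. [lc_sum] is
    a supremum over uncountably many pairs and is not known to be measurable beforehand, so
    almost-everywhere equality is out of reach; instead, a deficit [eta] throughout a ball would
    already change the integral, hence near-equality occurs arbitrarily close to every point.
    Moreover [f] and [k] are continuous only on their supports. Globally they are upper
    semicontinuous, which suffices for the side with the square roots, whereas the side with the
    midpoints needs interior midpoints; a maximizer is therefore asked for equality only there.

    Afterwards one mechanism carries the proof: equality at [(x, y)] forces [x'] into both interiors
    as soon as its midpoints with [x] and [y] are there, which turns convexity into expansion. The
    factor [2 ^+ n] is the Jacobian of the midpoint substitution. The lattice argument is algebraic: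
    the recession cone of the open cone plays the part of its closure, with the Archimedean property
    in place of closedness. *)

Section IteratedIntegral.
Variable R : realType.
Implicit Types (n : nat).

Notation leb := (@lebesgue_measure R).

(* Coordinatewise formulation of Borel measurability: it composes freely and
   avoids putting a sigma-algebra on ['rV[R]_n]. *)
Definition mfun n (F : 'rV[R]_n -> \bar R) : Prop :=
  forall d (T : measurableType d) (c : 'I_n -> T -> R),
    (forall i, measurable_fun setT (c i)) ->
    measurable_fun setT (fun t => F (\row_i c i t)).

(** The parameter is precomposed with a measurable [s] so that the notion survives moving a
    coordinate into the parameter space, as the induction on the dimension requires. *)
Definition mfunp d (T : measurableType d) n (F : T -> 'rV[R]_n -> \bar R) : Prop :=
  forall d' (T' : measurableType d') (s : T' -> T) (c : 'I_n -> T' -> R),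
    measurable_fun setT s -> (forall i, measurable_fun setT (c i)) ->
    measurable_fun setT (fun t => F (s t) (\row_i c i t)).

Definition mfun2 m n (F : 'rV[R]_m -> 'rV[R]_n -> \bar R) : Prop :=
  forall d (T : measurableType d) (b : 'I_m -> T -> R) (c : 'I_n -> T -> R),
    (forall i, measurable_fun setT (b i)) ->
    (forall i, measurable_fun setT (c i)) ->
    measurable_fun setT (fun t => F (\row_i b i t) (\row_i c i t)).

Definition ccons T m (s : T -> R) (c : 'I_m -> T -> R) (i : 'I_(1 + m)) : T -> R :=
  match fintype.split i with inl _ => s | inr j => c j end.

Lemma row_mx_ccons T m (s : T -> R) (c : 'I_m -> T -> R) t :
  row_mx (\row_(j < 1) s t) (\row_i c i t) = \row_i ccons s c i t.
Proof.
apply/rowP => i; rewrite !mxE /ccons; by case: fintype.split => j; rewrite mxE.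
Qed.

Lemma measurable_ccons d (T : measurableType d) m (s : T -> R) (c : 'I_m -> T -> R) :
  measurable_fun setT s -> (forall i, measurable_fun setT (c i)) ->
  forall i, measurable_fun setT (ccons s c i).
Proof. by move=> ms mc i; rewrite /ccons; case: fintype.split. Qed.

Lemma row0_eq (x : 'rV[R]_0) : x = 0.
Proof. by apply/rowP; case. Qed.

Lemma iint_ge0 n (F : 'rV[R]_n -> \bar R) :
  (forall x, 0 <= F x)%E -> (0 <= iint F)%E.
Proof.
elim: n F => [|n IH] F F0 /=; first exact: F0.
by apply: integral_ge0 => t _; apply: IH => x; exact: F0.
Qed.

Lemma eq_iint n (F G : 'rV[R]_n -> \bar R) : (forall x, F x = G x) -> iint F = iint G.
Proof. by move=> FG; congr iint; apply/funext. Qed.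

Lemma le_nnintegral d (T : measurableType d) (mu : {measure set T -> \bar R})
    (f g : T -> \bar R) :
  (forall x, 0 <= f x)%E -> (forall x, f x <= g x)%E ->
  (\int[mu]_x f x <= \int[mu]_x g x)%E.
Proof.
move=> f0 fg; have g0 x : (0 <= g x)%E by apply: le_trans (fg x).
rewrite !ge0_integralTE//; apply: ereal_sup_le; apply: image_subset => h /= hf x.
exact: le_trans (fg x).
Qed.

(* For nonnegative integrands [integral] is a supremum over the simple functions
   lying below; this is how the possibly irregular [lc_sum] gets integrated. *)
Lemma le_iint n (F G : 'rV[R]_n -> \bar R) :
  (forall x, 0 <= F x)%E -> (forall x, F x <= G x)%E -> (iint F <= iint G)%E.
Proof.
elim: n F G => [|n IH] F G F0 FG /=; first exact: FG.
apply: le_nnintegral => t; first by apply: iint_ge0.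
by apply: IH.
Qed.

Lemma measurable_iintp d (T : measurableType d) n (F : T -> 'rV[R]_n -> \bar R) :
  mfunp F -> (forall t x, 0 <= F t x)%E ->
  measurable_fun setT (fun t => iint (F t)).
Proof.
elim: n d T F => [|n IH] d T F mF F0 /=.
  have := mF d T id (fun _ _ => 0).
  rewrite (_ : (fun t => _) = (fun t => F t 0)).
    by apply=> // -[].
  by apply/funext => t; congr F; exact: row0_eq.
pose G (p : T * R) (v : 'rV[R]_n) := F p.1 (row_mx (\row_(j < 1) p.2) v).
have mG : measurable_fun setT (fun p => iint (G p)).
  apply: IH => [d' T' s c ms mc|p v]; last exact: F0.
  rewrite /G; under eq_fun do rewrite (row_mx_ccons (fun t => (s t).2)).
  apply: mF; first exact: measurableT_comp.
  by apply: measurable_ccons => //; exact: measurableT_comp.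
apply: (measurable_fun_fubini_tonelli_F (m2 := leb) _ mG) => p.
by apply: iint_ge0 => x; exact: F0.
Qed.

Lemma mfunp_slice n (F : 'rV[R]_n.+1 -> \bar R) :
  mfun F -> mfunp (fun (t : R) (v : 'rV[R]_n) => F (row_mx (\row_(j < 1) t) v)).
Proof.
move=> mF d' T' s c ms mc; under eq_fun do rewrite row_mx_ccons.
by apply: mF; exact: measurable_ccons.
Qed.

Lemma mfun_slice n (F : 'rV[R]_n.+1 -> \bar R) t :
  mfun F -> mfun (fun v : 'rV[R]_n => F (row_mx (\row_(j < 1) t) v)).
Proof.
move=> mF d' T' c mc.
rewrite (_ : (fun _ => _) = fun u => F (row_mx (\row_(j < 1) (cst t) u) (\row_i c i u)))//.
under eq_fun do rewrite row_mx_ccons.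
by apply: mF; apply: measurable_ccons => //.
Qed.

Lemma measurable_iint_slice n (F : 'rV[R]_n.+1 -> \bar R) :
  mfun F -> (forall x, 0 <= F x)%E ->
  measurable_fun setT (fun t : R => iint (fun v : 'rV[R]_n => F (row_mx (\row_(j < 1) t) v))).
Proof. by move=> mF F0; apply: measurable_iintp => //; exact: mfunp_slice. Qed.

Lemma iintD n (F G : 'rV[R]_n -> \bar R) :
  mfun F -> mfun G -> (forall x, 0 <= F x)%E -> (forall x, 0 <= G x)%E ->
  iint (fun x => F x + G x)%E = (iint F + iint G)%E.
Proof.
elim: n F G => [|n IH] F G mF mG F0 G0 //=.
rewrite -ge0_integralD//=.
- apply: eq_integral => t _; rewrite IH//; exact: mfun_slice.
- by move=> t _; apply: iint_ge0.
- exact: measurable_iint_slice.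
- by move=> t _; apply: iint_ge0.
- exact: measurable_iint_slice.
Qed.

Lemma iintZ n (k : \bar R) (F : 'rV[R]_n -> \bar R) :
  mfun F -> (forall x, 0 <= F x)%E -> (0 <= k)%E ->
  iint (fun x => k * F x)%E = (k * iint F)%E.
Proof.
elim: n F => [|n IH] F mF F0 k0 //=.
rewrite -ge0_integralZl//=.
- apply: eq_integral => t _; rewrite IH//; exact: mfun_slice.
- exact: measurable_iint_slice.
- by move=> t _; apply: iint_ge0.
Qed.

Lemma iint_sum n (I : Type) (s : seq I) (F : I -> 'rV[R]_n -> \bar R) :
  (forall i, mfun (F i)) -> (forall i x, 0 <= F i x)%E ->
  mfun (fun x => \sum_(i <- s) F i x)%E /\
  iint (fun x => \sum_(i <- s) F i x)%E = (\sum_(i <- s) iint (F i))%E.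
Proof.
move=> mF F0.
have mS r : mfun (fun x => \sum_(i <- r) F i x)%E.
  move=> d T c mc; apply: emeasurable_sum => i; exact: mF.
split => //; elim: s => [|a s IH].
  (* The integral of the zero function is read off from homogeneity with factor 0. *)
  rewrite big_nil (eq_iint (G := fun x => (0 * 0)%E)); last by move=> x; rewrite big_nil mule0.
  by rewrite iintZ ?mul0e// => d T c mc.
rewrite big_cons -IH -iintD//; last by move=> x; apply: sume_ge0.
by apply: eq_iint => x; rewrite big_cons.
Qed.

Lemma mfunp_curve m n (F : 'rV[R]_m -> 'rV[R]_n -> \bar R) d (T : measurableType d)
    (b : 'I_m -> T -> R) :
  mfun2 F -> (forall i, measurable_fun setT (b i)) ->
  mfunp (fun t => F (\row_i b i t)).
Proof.
move=> mF mb d' T' s c ms mc; apply: (mF _ _ (fun i => b i \o s)) => // i.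
exact: measurableT_comp.
Qed.

Lemma mfun_iint m n (F : 'rV[R]_m -> 'rV[R]_n -> \bar R) :
  mfun2 F -> (forall x y, 0 <= F x y)%E -> mfun (fun x => iint (F x)).
Proof.
move=> mF F0 d T b mb; apply: measurable_iintp => //; exact: mfunp_curve.
Qed.

(** Tonelli on the plane moves the real variable past the first coordinate; induction moves it past
    the others. [iint_swap] then peels off the coordinates of [x] one by one. *)
Lemma integral_iint n (K : R -> 'rV[R]_n -> \bar R) :
  mfunp K -> (forall t x, 0 <= K t x)%E ->
  (\int[leb]_t iint (K t) = iint (fun x => \int[leb]_t K t x))%E.
Proof.
elim: n K => [|n IH] K mK K0 //=.
pose G (p : R * R) (v : 'rV[R]_n) := K p.1 (row_mx (\row_(j < 1) p.2) v).
have mG : measurable_fun setT (fun p => iint (G p)).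
  apply: measurable_iintp => [d' T' s c ms mc|p v]; last exact: K0.
  rewrite /G; under eq_fun do rewrite (row_mx_ccons (fun t => (s t).2)).
  apply: mK; first exact: measurableT_comp.
  by apply: measurable_ccons => //; exact: measurableT_comp.
rewrite (fubini_tonelli (m1 := leb) (m2 := leb) _ mG); last first.
  by move=> p; apply: iint_ge0 => x; exact: K0.
apply: eq_integral => s _; rewrite /= IH//; last by move=> t x; exact: K0.
move=> d' T' r c mr mc.
rewrite (_ : (fun _ => _) = fun u => K (r u) (row_mx (\row_(j < 1) (cst s) u) (\row_i c i u)))//.
under eq_fun do rewrite row_mx_ccons.
by apply: mK => //; apply: measurable_ccons.
Qed.

Lemma iint_swap m n (F : 'rV[R]_m -> 'rV[R]_n -> \bar R) :
  mfun2 F -> (forall x y, 0 <= F x y)%E ->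
  iint (fun x => iint (F x)) = iint (fun y => iint (fun x => F x y)).
Proof.
elim: m F => [|m IH] F mF F0 //=.
have mF' t : mfun2 (fun v => F (row_mx (\row_(j < 1) t) v)).
  move=> d T b c mb mc.
  rewrite (_ : (fun _ => _) = fun u => F (row_mx (\row_(j < 1) (cst t) u) (\row_i b i u))
     (\row_i c i u))//.
  under eq_fun do rewrite row_mx_ccons.
  by apply: mF => //; apply: measurable_ccons.
under eq_integral do rewrite IH//.
rewrite (integral_iint (K := fun t y => iint (fun v => F (row_mx (\row_(j < 1) t) v) y)))//.
  move=> d T s c ms mc.
  apply: (measurable_iintp (F := fun t v => F (row_mx (\row_(j < 1) s t) v) (\row_i c i t))) => //.
  move=> d' T' r b mr mb.
  rewrite (_ : (fun _ => _) = fun u => F (row_mx (\row_(j < 1) (s \o r) u) (\row_i b i u))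
     (\row_i (c i \o r) u))//.
  under eq_fun do rewrite row_mx_ccons.
  apply: mF; [|by move=> i; exact: (measurableT_comp (mc i) mr)].
  by apply: measurable_ccons => //; exact: (measurableT_comp ms mr).
by move=> t x; apply: iint_ge0.
Qed.

End IteratedIntegral.

(** * Affine changes of variables *)

Section AffineChange.
Variable R : realType.
Notation leb := (@lebesgue_measure R).

Lemma measurable_affine (c a : R) :
  measurable_fun setT (fun t : measurableTypeR R => (c * t + a : measurableTypeR R)).
Proof.
apply: measurable_funD; last exact: measurable_cst.
by apply: measurable_funM => //; exact: measurable_id.
Qed.

(** Uniqueness of Lebesgue measure: [|c|] times the push-forward gives each interval []x, y]] its
    length. For [c < 0] the preimage is closed on the left instead, hence the two cases. *)
Lemma lebesgue_affine (c a : R) (A : set (measurableTypeR R)) : c != 0 -> measurable A ->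
  leb ((fun t => c * t + a) @^-1` A) = (`|c|^-1%:E * leb A)%E.
Proof.
move=> c0 mA.
have [P PE] : exists P : {measure set (measurableTypeR R) -> \bar R},
    forall A, P A = leb ((fun t : measurableTypeR R => c * t + a : measurableTypeR R) @^-1` A).
  unshelve eexists (pushforward leb (fun t : measurableTypeR R => c * t + a : measurableTypeR R)
    : {measure set (measurableTypeR R) -> \bar R}) => //.
  exact: measurable_affine.
have nc0 : 0 <= `|c| by [].
have -> : leb A = (`|c|%:E * P A)%E.
  apply: (@lebesgue_measure_unique R (mscale (NngNum nc0) P)) mA.
  move=> X [[x y] _ <-] /=; rewrite /mscale /= PE.
  case: (ltrgt0P c) c0 => // c0 _.
  - rewrite (_ : _ @^-1` _ = `] ((x - a) / c), ((y - a) / c)]%classic); last first.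
      apply/seteqP; split=> t /=; rewrite !in_itv /= ltr_pdivrMr// ler_pdivlMr//;
        by rewrite ltrBlDr lerBrDr mulrC.
    rewrite !lebesgue_measure_itv /= !lte_fin ltr_pM2r ?invr_gt0// ltrD2r.
    case: ifP; last by rewrite mule0.
    by move=> _; rewrite -!EFinD -EFinM; congr EFin; field; rewrite gt_eqF.
  - rewrite (_ : _ @^-1` _ = `[ ((y - a) / c), ((x - a) / c)[%classic); last first.
      apply/seteqP; split=> t /=; rewrite !in_itv /= ltr_ndivlMr// ler_ndivrMr//;
        by rewrite ltrBlDr lerBrDr mulrC andbC.
    rewrite !lebesgue_measure_itv /= !lte_fin ltr_nM2r ?invr_lt0// ltrD2r.
    case: ifP; last by rewrite mule0.
    by move=> _; rewrite -!EFinD -EFinM; congr EFin; field; rewrite lt_eqF.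
by rewrite PE muleA -EFinM mulVf ?mul1e ?normr_eq0.
Qed.

Lemma integral_affine (c a : R) (F : R -> \bar R) : c != 0 ->
  measurable_fun setT F -> (forall t, 0 <= F t)%E ->
  (\int[leb]_t F (c * t + a)%R = `|c|^-1%:E * \int[leb]_t F t)%E.
Proof.
move=> c0 mF F0.
have E := @ge0_integral_pushforward _ _ _ _ R _ (measurable_affine c a) leb setT F measurableT mF.
rewrite preimage_setT in E; rewrite -[LHS]E; last by move=> x _; exact: F0.
have nc0 : 0 <= `|c|^-1 by rewrite invr_ge0.
rewrite -[_%:E]/((NngNum nc0)%:num%:E) -ge0_integral_mscale//.
have [P PE] : exists P : {measure set (measurableTypeR R) -> \bar R},
    (P : set (measurableTypeR R) -> \bar R) = pushforward leb (fun t : measurableTypeR R => c * t + a : measurableTypeR R).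
  unshelve eexists (pushforward leb (fun t : measurableTypeR R => c * t + a : measurableTypeR R)
    : {measure set (measurableTypeR R) -> \bar R}) => //.
  exact: measurable_affine.
rewrite -PE; apply: eq_measure_integral => A mA _.
by rewrite PE /pushforward /= lebesgue_affine.
Qed.

Lemma affine_row_mx n (c t : R) (w : 'rV[R]_n) (v : 'rV[R]_(1 + n)) :
  c *: row_mx (\row_(j < 1) t) w + v =
  row_mx (\row_(j < 1) (c * t + v ord0 ord0)) (c *: w + rsubmx v).
Proof.
rewrite -{1}(@hsubmxK R 1 1 n v) scale_row_mx add_row_mx; congr row_mx.
by apply/rowP => j; rewrite !mxE ord1; congr (_ + v _ _); apply: val_inj.
Qed.

Lemma iint_affine n (c : R) (v : 'rV[R]_n) (F : 'rV[R]_n -> \bar R) : c != 0 ->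
  mfun F -> (forall x, 0 <= F x)%E ->
  iint (fun x => F (c *: x + v)) = ((`|c|^-1 ^+ n)%:E * iint F)%E.
Proof.
move=> c0; elim: n v F => [|n IH] v F mF F0 /=.
  by rewrite expr0 mul1e; congr F; exact: row0_eq.
pose G t := iint (fun w : 'rV[R]_n => F (row_mx (\row_(j < 1) t) w)).
transitivity (\int[leb]_t ((`|c|^-1 ^+ n)%:E * G (c * t + v ord0 ord0)%R))%E.
  apply: eq_integral => t _; rewrite /G -(IH (rsubmx (v : 'rV_(1 + n))))//; last exact: mfun_slice.
  by apply: eq_iint => w; exact: (congr1 F (affine_row_mx c t w v)).
have mG : measurable_fun setT G by exact: measurable_iint_slice.
have G0 t : (0 <= G t)%E by exact: iint_ge0.
have k0 : (0 <= (`|c|^-1 ^+ n)%:E)%E by rewrite lee_fin exprn_ge0// invr_ge0.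
rewrite ge0_integralZl//; last first.
  by apply: (measurableT_comp mG); exact: measurable_affine.
by rewrite integral_affine// muleA -EFinM exprSr.
Qed.

End AffineChange.

(** * Sup-norm balls and Borel measurability by coordinates *)

Section BallsAndMeasurability.
Variable R : realType.
Notation leb := (@lebesgue_measure R).

Lemma row_ballE n (p x : 'rV[R]_n) (r : R) :
  ball p r x <-> 0 < r /\ forall i, `|p ord0 i - x ord0 i| < r.
Proof.
split=> [[r0 H]|[r0 H]]; split=> //.
  by move=> i; exact: H.
by move=> i j; rewrite ord1; exact: H.
Qed.

Lemma measurable_row_ball n d (T : measurableType d) (c : 'I_n -> T -> R)
    (p : 'rV[R]_n) (r : R) :
  (forall i, measurable_fun setT (c i)) -> measurable [set t | ball p r (\row_i c i t)].
Proof.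
move=> mc; have [r0|r0] := ltP 0 r; last first.
  rewrite (_ : [set _ | _] = set0)//; apply/seteqP; split=> t //=.
  by move=> [r0']; rewrite ltNge r0 in r0'.
rewrite (_ : [set _ | _] = \bigcap_(i in [set: 'I_n]) [set t | `|p ord0 i - c i t| < r]).
  apply: fin_bigcap_measurable => [|i _]; first exact: finite_finset.
  have mf : measurable_fun setT (fun t => `|p ord0 i - c i t|).
    by apply: measurableT_comp => //; apply: measurable_funB.
  have := @measurable_fun_ltr _ _ R setT _ (cst r) mf (measurable_cst _).
  by move/(_ measurableT [set true] Logic.I); rewrite setTI.
apply/seteqP; split=> t /=.
  by move/row_ballE => [_ H] i _; have := H i; rewrite mxE.
by move=> H; apply/row_ballE; split=> // i; have := H i Logic.I; rewrite mxE.
Qed.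

(** An open set is the countable union of the rational cubes it contains. *)
Lemma measurable_row_open n d (T : measurableType d) (c : 'I_n -> T -> R)
    (U : set 'rV[R]_n) :
  open U -> (forall i, measurable_fun setT (c i)) -> measurable [set t | U (\row_i c i t)].
Proof.
move=> oU mc.
pose B (q : 'rV[rat]_n * rat) : set 'rV[R]_n := ball (map_mx (ratr : rat -> R) q.1) (ratr q.2).
rewrite (_ : [set _ | _] = \bigcup_(q in setT)
    [set t | B q `<=` U /\ B q (\row_i c i t)]).
  apply: countable_bigcupT_measurable => [|q]; first exact: countableP.
  have [BU|BU] := pselect (B q `<=` U); last first.
    by rewrite (_ : [set _ | _] = set0)//; apply/seteqP; split=> t //= -[].
  rewrite (_ : [set _ | _] = [set t | B q (\row_i c i t)]); first exact: measurable_row_ball.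
  by apply/seteqP; split=> t //= -[].
apply/seteqP; split=> t /=; last first.
  by case=> q _ [Hq qt]; exact: Hq.
move=> Ut; have /nbhs_ballP[e /= e0 He] : nbhs (\row_i c i t) U by exact: open_nbhs_nbhs.
(* With a centre within [e / 4] of the point in each coordinate and a radius between [e / 4] and
   [e / 2], the cube contains the point and stays within [3e/4] of it. *)
have [r /[!in_itv]/= /andP[r1 r2]] : exists r : rat, ratr r \in `](e / 4), (e / 2)[.
  by apply: rat_in_itvoo; lra.
have /choice[q Hq] : forall i, exists q : rat, ratr q \in `](c i t - e / 4), (c i t + e / 4)[.
  by move=> i; apply: rat_in_itvoo; lra.
exists (\row_i q i, r) => //; split=> /=.
  move=> x /row_ballE [_ Bx]; apply: He; apply/row_ballE; split=> // i.
  have := Bx i; have := Hq i; rewrite !mxE in_itv/= => /andP[h1 h2].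
  rewrite ltr_norml => /andP[h3 h4]; rewrite ltr_norml; apply/andP; split; lra.
apply/row_ballE; split=> [|i]; first lra.
have := Hq i; rewrite !mxE in_itv/= => /andP[h1 h2].
rewrite ltr_norml; apply/andP; split; lra.
Qed.

Definition bind n (p : 'rV[R]_n) (r : R) (x : 'rV[R]_n) : R := \1_(ball p r) x.

Lemma bind_ge0 n (p : 'rV[R]_n) r x : 0 <= bind p r x.
Proof. by rewrite /bind indicE. Qed.

Lemma mfun_bind n (p : 'rV[R]_n) (r : R) : mfun (fun x => (bind p r x)%:E).
Proof.
move=> d T c mc; apply/measurable_EFinP.
rewrite (_ : (fun t => _) = \1_[set t | ball p r (\row_i c i t)]).
  by apply: measurable_indic; exact: measurable_row_ball.
by apply/funext => t; rewrite /bind !indicE; congr (nat_of_bool _)%:R; apply/idP/idP; rewrite !inE.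
Qed.

(** Balls of ['rV[R]_n] are cubes, so the indicator is a product over the coordinates, each
    contributing a factor [2 * r]. *)
Lemma iint_bind n (p : 'rV[R]_n) (r : R) : 0 < r ->
  iint (fun x => (bind p r x)%:E) = ((2 * r) ^+ n)%:E.
Proof.
move=> r0; elim: n p => [|n IH] p /=.
  by rewrite expr0 /bind indicE mem_set//; apply/row_ballE; split=> // -[].
pose p0 := p ord0 ord0; pose p1 : 'rV[R]_n := rsubmx (p : 'rV_(1 + n)).
have E t w : (bind p r (row_mx (\row_(j < 1) t) w))%:E =
    ((\1_(`]p0 - r, p0 + r[%classic : set R) t)%:E * (bind p1 r w)%:E)%E.
  rewrite -EFinM /bind !indicE -natrM mulnb; congr (_%:R%:E); congr nat_of_bool.
  apply/idP/andP.
    rewrite !inE => /row_ballE [_ H]; split => /=.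
      have := H (lshift n (ord0 : 'I_1)); rewrite mxE.
      case: splitP => // j _; rewrite mxE /= in_itv/=.
      have -> : lshift n (ord0 : 'I_1) = ord0 by apply: val_inj.
      by rewrite -/p0 ltr_norml => /andP[h1 h2]; apply/andP; split; lra.
    apply/row_ballE; split=> // i; have := H (rshift 1 i).
    rewrite mxE; case: splitP => [j|k] /= ij; first by have := ltn_ord j; rewrite -ij.
    by have -> : k = i; [exact/val_inj/esym/(@addnI 1)|rewrite mxE].
  rewrite !inE => -[]; rewrite /= in_itv/= => /andP[h1 h2] /row_ballE[_ H].
  apply/row_ballE; split=> // i; rewrite mxE; case: splitP => j.
    move=> ij; have -> : i = ord0 by apply: val_inj; exact: (etrans ij (congr1 val (ord1 j))).
    by rewrite -/p0 mxE ltr_norml; apply/andP; split; lra.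
  move=> ij; have -> : i = rshift 1 j by apply: val_inj; exact: ij.
  by have := H j; rewrite mxE.
under eq_integral.
  move=> t _.
  rewrite (eq_iint (E t)) (iintZ (@mfun_bind _ p1 r)); last 2 first.
  - by move=> x; rewrite lee_fin bind_ge0.
  - by rewrite lee_fin indicE.
  rewrite IH muleC; over.
have mI : measurable_fun [set: measurableTypeR R]
    (EFin \o (\1_(`]p0 - r, p0 + r[%classic : set R) : measurableTypeR R -> R)).
  by apply/measurable_EFinP; apply: measurable_indic; exact: measurable_itv.
rewrite (ge0_integralZl _ measurableT mI); last 2 first.
- by move=> t _; rewrite lee_fin indicE.
- by rewrite lee_fin exprn_ge0// mulr_ge0// ltW.
rewrite integral_indic// setIT exprSr EFinM; congr (_ * _)%E.
apply: (etrans (lebesgue_measure_itv `]p0 - r, p0 + r[)) => /=.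
rewrite lte_fin ifT; last lra.
by rewrite -EFinB; congr EFin; ring.
Qed.

End BallsAndMeasurability.

(** * Log-concave functions *)

Section LogConcave.
Variables (R : realType) (n : nat).
Implicit Types (f g : 'rV[R]_n -> R) (x y : 'rV[R]_n).

Lemma log_concave_ge0 f x : log_concave f -> 0 <= f x.
Proof.
move=> [u [_ [_ /(_ x) fE]]].
by rewrite -lee_fin fE expeR_ge0.
Qed.

(** Trades the extended-valued [u] for [ln f]: [u] is finite exactly where [f > 0], so later
    arguments stay among real numbers. *)
Lemma log_concave_val f : log_concave f ->
  exists u : 'rV[R]_n -> \bar R, convex_ext u /\
    forall x, (0 < f x -> u x = (- ln (f x))%:E) /\
      forall r, (u x <= r%:E)%E -> 0 < f x /\ - ln (f x) <= r.
Proof.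
move=> [u [uNy [cu fE]]]; exists u; split=> // x.
move: (fE x) (uNy x); case: (u x) => [s| |] //= fx _.
  have -> : f x = expR (- s) by case: fx.
  by rewrite expRK opprK; split=> // r; rewrite lee_fin expR_gt0.
have -> : f x = 0 by case: fx.
by rewrite ltxx; split=> // r; rewrite leye_eq.
Qed.

Lemma log_concave_ln f x y (t : R) : log_concave f -> 0 < f x -> 0 < f y ->
  0 <= t <= 1 ->
  0 < f ((1 - t) *: x + t *: y) /\
  (1 - t) * ln (f x) + t * ln (f y) <= ln (f ((1 - t) *: x + t *: y)).
Proof.
move=> /log_concave_val[u [cu uE]] fx fy t01.
have ux : (u x <= (- ln (f x))%:E)%E by rewrite (uE x).1.
have uy : (u y <= (- ln (f y))%:E)%E by rewrite (uE y).1.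
have [H1 H2] := (uE _).2 _ (cu x y _ _ t ux uy t01).
by split=> //; lra.
Qed.

Lemma log_concave_min f x y (t m : R) : log_concave f -> 0 < m -> m <= f x -> m <= f y ->
  0 <= t <= 1 -> m <= f ((1 - t) *: x + t *: y).
Proof.
move=> lf m0 mx my t01.
have fx : 0 < f x by apply: lt_le_trans mx.
have fy : 0 < f y by apply: lt_le_trans my.
have [H1 H2] := log_concave_ln lf fx fy t01.
rewrite -ler_ln ?posrE//; apply: le_trans H2.
have : ln m <= ln (f x) by rewrite ler_ln ?posrE.
have : ln m <= ln (f y) by rewrite ler_ln ?posrE.
by move: t01 => /andP[t0 t1]; nra.
Qed.

Lemma continuous_affine (c : R) (v : 'rV[R]_n) : continuous (fun z : 'rV[R]_n => c *: z + v).
Proof.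
move=> z; have h1 : c *: z @[z --> z] --> c *: z by exact: scaler_continuous.
exact: (cvgD h1 (cvg_cst v)).
Qed.

Lemma continuous_reflect (v : 'rV[R]_n) : continuous (fun z : 'rV[R]_n => v - z).
Proof.
have E : (fun z : 'rV[R]_n => v - z) = (fun z => -1 *: z + v).
  by apply/funext => z; rewrite scaleN1r addrC.
rewrite E; exact: continuous_affine.
Qed.

Lemma continuous_comb (a b : R) (v : 'rV[R]_n) :
  continuous (fun p : 'rV[R]_n * 'rV[R]_n => a *: p.1 + b *: p.2 + v).
Proof.
move=> [x y].
have sc (k : R) (z : 'rV[R]_n) : k *: w @[w --> z] --> k *: z by exact: scaler_continuous.
have h1 : a *: p.1 @[p --> (x, y)] --> a *: x.
  by apply: (cvg_comp fst (fun z : 'rV[R]_n => a *: z) _ (sc a x)); exact: cvg_fst.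
have h2 : b *: p.2 @[p --> (x, y)] --> b *: y.
  by apply: (cvg_comp snd (fun z : 'rV[R]_n => b *: z) _ (sc b y)); exact: cvg_snd.
exact: (cvgD (cvgD h1 h2) (cvg_cst v)).
Qed.

Lemma half_mid x y : 2^-1 *: (x + y) = (1 - 2^-1) *: x + 2^-1 *: y.
Proof. by rewrite scalerDr; congr (_ *: _ + _); field. Qed.

Lemma log_concave_mid f x y : log_concave f ->
  f x * f y <= f (2^-1 *: (x + y)) ^+ 2.
Proof.
move=> lf.
have [fx|] := ltP 0 (f x); last first.
  move=> fx0; have -> : f x = 0 by apply/le_anti; rewrite fx0 log_concave_ge0.
  by rewrite mul0r sqr_ge0.
have [fy|] := ltP 0 (f y); last first.
  move=> fy0; have -> : f y = 0 by apply/le_anti; rewrite fy0 log_concave_ge0.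
  by rewrite mulr0 sqr_ge0.
have h01 : 0 <= (2^-1 : R) <= 1 by apply/andP; split; lra.
have [H1 H2] := log_concave_ln lf fx fy h01.
rewrite half_mid -ler_ln ?posrE ?mulr_gt0 ?exprn_gt0//.
rewrite lnM ?posrE// lnXn// mulr2n; lra.
Qed.

Lemma supp_conv f x y (t : R) : log_concave f -> supp f x -> supp f y ->
  0 <= t <= 1 -> supp f ((1 - t) *: x + t *: y).
Proof.
move=> lf Kx Ky t01 B nB.
pose h (p : 'rV[R]_n * 'rV[R]_n) := (1 - t) *: p.1 + t *: p.2.
have ch : {for (x, y), continuous h}.
  have := @continuous_comb (1 - t) t 0 (x, y).
  by rewrite (_ : (fun _ => _) = h)//; apply/funext => p; rewrite addr0.
have [[U V] [/= Ux Vy] UV] := ch _ nB.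
have [x' [fx' Ux']] := Kx _ Ux; have [y' [fy' Vy']] := Ky _ Vy.
exists (h (x', y')); split; last exact: (UV (x', y')).
have {}fx' : 0 < f x' by rewrite lt_def fx' log_concave_ge0.
have {}fy' : 0 < f y' by rewrite lt_def fy' log_concave_ge0.
by rewrite /= gt_eqF//; case: (log_concave_ln lf fx' fy' t01).
Qed.

Lemma pos_supp f x : 0 < f x -> supp f x.
Proof. by move=> fx; apply: subset_closure; rewrite /= gt_eqF. Qed.

Lemma nsupp_eq0 f x : ~ supp f x -> f x = 0.
Proof. by move=> nK; apply/eqP/negPn/negP => fx; apply: nK; exact: subset_closure. Qed.

(** The homothety with centre [x] and ratio [t] carries a neighbourhood of [y] in the support to one
    of the combination; [h] is its inverse. The point [x] may lie on the boundary. *)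
Lemma supp_interior_conv f x y (t : R) : log_concave f -> supp f x ->
  interior (supp f) y -> 0 < t <= 1 -> interior (supp f) ((1 - t) *: x + t *: y).
Proof.
move=> lf Kx Ky /andP[t0 t1].
pose h z := t^-1 *: z + - (t^-1 *: ((1 - t) *: x)).
have ch : continuous h by exact: continuous_affine.
have hz : h ((1 - t) *: x + t *: y) = y.
  by rewrite /h scalerDr addrAC subrr add0r scalerA mulVf ?scale1r// gt_eqF.
have nb : nbhs ((1 - t) *: x + t *: y) (h @^-1` supp f).
  by have := ch ((1 - t) *: x + t *: y) (supp f); rewrite hz; exact.
change (nbhs ((1 - t) *: x + t *: y) (supp f)); apply: filterS nb => z /= Kh.
have -> : z = (1 - t) *: x + t *: h z.
  by rewrite /h scalerDr scalerN !scalerA ?mulrA mulfV ?gt_eqF// mul1r scale1r addrC subrK.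
by apply: supp_conv => //; rewrite ltW.
Qed.

Lemma continuous_interior f x : {within supp f, continuous f} ->
  interior (supp f) x -> {for x, continuous f}.
Proof.
move=> /subspace_continuousP cf ix.
have Kx : supp f x by exact: interior_subset.
move=> B /(cf x Kx) H; apply: (filterS2 _ _ ix H) => y Ky; exact.
Qed.

(** Off the closed support [f] vanishes, and on it [f] is continuous. The matching lower bound may
    fail at the boundary of the support. *)
Lemma usc f x (M : R) : log_concave f -> {within supp f, continuous f} -> f x < M ->
  \forall y \near x, f y < M.
Proof.
move=> lf /subspace_continuousP cf fM.
have M0 : 0 < M by apply: le_lt_trans fM; exact: log_concave_ge0.
have [Kx|nKx] := pselect (supp f x).
  have nb : nbhs (f x) [set r | r < M] by exact: lt_nbhsl.
  have H : \forall y \near x, supp f y -> f y < M := cf x Kx _ nb.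
  apply: filterS H => y Hy.
  have [/Hy//|nKy] := pselect (supp f y).
  by rewrite nsupp_eq0.
have : nbhs x (~` supp f).
  apply: open_nbhs_nbhs; split=> //; rewrite openC; exact: closed_closure.
by apply: filterS => y /= /nsupp_eq0 ->.
Qed.

Lemma interior_supp_gt0 f x : log_concave f -> {within supp f, continuous f} ->
  interior (supp f) x -> 0 < f x.
Proof.
move=> lf cf ix.
have Kx : supp f x by exact: interior_subset.
(* Points of [{f > 0}] accumulate at x, and so do their reflections through x,
   which form a neighbourhood inside the support. *)
have [y [fy iy]] : [set z | f z != 0] `&`
    ((fun z => 2 *: x - z) @^-1` interior (supp f) `&` interior (supp f)) !=set0.
  apply: Kx; apply: filterI; last exact: nbhs_interior.
  have c2 : {for x, continuous (fun z : 'rV[R]_n => 2 *: x - z)}.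
    exact: continuous_reflect.
  apply: (c2 (interior (supp f))); rewrite /= (_ : 2 *: x - x = x); first exact: nbhs_interior.
  by rewrite scaler_nat mulr2n addrK.
case: iy => iy1 iy2.
have {}fy : 0 < f y by rewrite lt_def fy log_concave_ge0.
have ny : \forall z \near y, 0 < f z.
  have nb : nbhs (f y) [set r | 0 < r] by exact: lt_nbhsr.
  exact: (continuous_interior cf iy2 nb).
have ny' : \forall z \near 2 *: x - y, 0 < f (2 *: x - z).
  have c2 : {for 2 *: x - y, continuous (fun z : 'rV[R]_n => 2 *: x - z)}.
    exact: continuous_reflect.
  by apply: (c2 [set z | 0 < f z]); rewrite /= opprB addrC subrK.
have Ky' : supp f (2 *: x - y) by exact: interior_subset iy1.
have [z [fz fz']] := Ky' _ ny'.
have {}fz : 0 < f z by rewrite lt_def fz log_concave_ge0.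
have h01 : 0 <= (2^-1 : R) <= 1 by apply/andP; split; lra.
have [H1 _] := log_concave_ln lf fz fz' h01.
move: H1; rewrite -half_mid addrC subrK scalerA mulVf ?scale1r//.
Qed.

(** For [a >= 0] the set where [a < f] is relatively open in the support, hence the trace of an open
    set on a closed one. *)
Lemma measurable_row_lc f d (T : measurableType d) (c : 'I_n -> T -> R) :
  log_concave f -> {within supp f, continuous f} ->
  (forall i, measurable_fun setT (c i)) ->
  measurable_fun setT (fun t => f (\row_i c i t)).
Proof.
move=> lf cf mc.
have mgt a : measurable [set t | a < f (\row_i c i t)].
  have [a0|a0] := ltP a 0.
    rewrite (_ : [set _ | _] = setT)//; apply/seteqP; split=> t //= _.
    by apply: lt_le_trans a0 _; exact: log_concave_ge0.
  have := (continuousP _).1 cf _ (@open_gt R a).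
  move=> /open_subspaceP[V oV VE].
  have {}VE x : (V x /\ supp f x) = (a < f x /\ supp f x).
    exact: (congr1 (fun S : set _ => S x) VE).
  rewrite (_ : [set _ | _] = [set t | V (\row_i c i t)] `&` ~` [set t | (~` supp f) (\row_i c i t)]).
    apply: measurableI; first exact: measurable_row_open.
    apply: measurableC; apply: measurable_row_open => //; rewrite openC; exact: closed_closure.
  apply/seteqP; split=> t /=.
    move=> aft; have Kt : supp f (\row_i c i t) by apply: pos_supp; exact: le_lt_trans aft.
    have [Vt _] : V (\row_i c i t) /\ supp f (\row_i c i t) by rewrite VE.
    by split=> // H; apply: H.
  move=> [Vt /contrapT Kt].
  have : V (\row_i c i t) /\ supp f (\row_i c i t) by split.
  by rewrite VE => -[].
apply: (measurability _ (RGenOInfty.measurableE R)) => _ [_ [a ->] <-].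
rewrite setTI (_ : _ @^-1` _ = [set t | a < f (\row_i c i t)])//.
by apply/seteqP; split=> t /=; rewrite in_itv/= andbT.
Qed.

Definition admissible f := [/\ log_concave f, (integral_Rn f < +oo)%E,
  interior (supp f) !=set0 & {within supp f, continuous f}].

End LogConcave.

(** * The inequality *)

Section Inequality.
Variables (R : realType) (n : nat).
Implicit Types (f g k : 'rV[R]_n -> R) (x y z : 'rV[R]_n).

Definition mrow f := forall d (T : measurableType d) (c : 'I_n -> T -> R),
  (forall i, measurable_fun setT (c i)) -> measurable_fun setT (fun t => f (\row_i c i t)).

Lemma mrow_lc f : log_concave f -> {within supp f, continuous f} -> mrow f.
Proof. by move=> lf cf d T c mc; exact: measurable_row_lc. Qed.

Lemma mfun_EFin f : mrow f -> mfun (fun x => (f x)%:E).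
Proof. by move=> mf d T c mc; apply/measurable_EFinP; exact: mf. Qed.

Lemma mrow_affine f (a : R) v : mrow f -> mrow (fun x => f (a *: x + v)).
Proof.
move=> mf d T c mc.
rewrite (_ : (fun t => _) = (fun t => f (\row_i (fun i t => a * c i t + v ord0 i) i t))).
  apply: mf => i; apply: measurable_funD => //; exact: measurable_funM.
by apply/funext => t; congr f; apply/rowP => i; rewrite !mxE.
Qed.

Lemma mrowM f k : mrow f -> mrow k -> mrow (fun x => f x * k x).
Proof. by move=> mf mk d T c mc; apply: measurable_funM; [exact: mf|exact: mk]. Qed.

Lemma mrow_sqrt f : mrow f -> mrow (fun x => Num.sqrt (f x)).
Proof.
move=> mf d T c mc; apply: (measurableT_comp (f := @Num.sqrt R)) (mf _ _ _ mc).
by apply: continuous_measurable_fun; exact: sqrt_continuous.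
Qed.

(** For [k = refl g] this is the convolution of [f] and [g] at [z]. *)
Definition convr f k z : \bar R := iint (fun u => (f u * k (u - z))%:E).
Definition isqrt f k : \bar R := iint (fun x => (Num.sqrt (f x * k x))%:E).

Lemma convr_ge0 f k z : (forall x, 0 <= f x) -> (forall x, 0 <= k x) -> (0 <= convr f k z)%E.
Proof. by move=> f0 k0; apply: iint_ge0 => x; rewrite lee_fin mulr_ge0. Qed.

Lemma isqrt_ge0 f k : (0 <= isqrt f k)%E.
Proof. by apply: iint_ge0 => x; rewrite lee_fin sqrtr_ge0. Qed.

Lemma mfun_isqrt f k : mrow f -> mrow k -> mfun (fun x => (Num.sqrt (f x * k x))%:E).
Proof. by move=> mf mk; apply: mfun_EFin; apply: mrow_sqrt; exact: mrowM. Qed.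

Lemma mfun2_convr f k : mrow f -> mrow k -> mfun2 (fun z u => (f u * k (u - z))%:E).
Proof.
move=> mf mk d T b c mb mc; apply/measurable_EFinP; apply: measurable_funM; first exact: mf.
rewrite (_ : (fun t => _) = (fun t => k (\row_i (fun i t => c i t - b i t) i t))).
  by apply: mk => i; exact: measurable_funB.
by apply/funext => t; congr k; apply/rowP => i; rewrite !mxE.
Qed.

Lemma mfun_convr f k : mrow f -> mrow k -> (forall x, 0 <= f x) -> (forall x, 0 <= k x) ->
  mfun (convr f k).
Proof.
move=> mf mk f0 k0; apply: (mfun_iint (mfun2_convr mf mk)) => x y.
by rewrite lee_fin mulr_ge0.
Qed.

Lemma sqrt_mid_le f k x y x' : log_concave f -> log_concave k ->
  Num.sqrt (f x * k y) * Num.sqrt (f x' * k x') <=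
  f (2^-1 *: (x + x')) * k (2^-1 *: (y + x')).
Proof.
move=> lf lk; rewrite -sqrtrM ?mulr_ge0 ?log_concave_ge0//.
have f0 := log_concave_ge0; rewrite -[leRHS]ger0_norm ?mulr_ge0 ?f0//.
rewrite -sqrtr_sqr ler_sqrt ?sqr_ge0// mulrACA exprMn.
by apply: ler_pM; rewrite ?mulr_ge0 ?f0 ?log_concave_mid.
Qed.

(* Substituting the midpoint of [x] and [x'] for the integration variable. *)
Lemma convr_midpoint f k x y z : mrow f -> mrow k ->
  (forall x, 0 <= f x) -> (forall x, 0 <= k x) -> x - y = 2 *: z ->
  iint (fun x' => (f (2^-1 *: (x + x')) * k (2^-1 *: (y + x')))%:E) =
  ((2 ^+ n)%:E * convr f k z)%E.
Proof.
move=> mf mk f0 k0 xyz.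
have h0 : 2^-1 != 0 :> R by rewrite invr_eq0 pnatr_eq0.
have mF : mfun (fun u => (f u * k (u - z))%:E).
  apply/mfun_EFin/mrowM => //.
  have := @mrow_affine _ 1 (- z) mk.
  by congr mrow; apply/funext => u; rewrite scale1r.
have F0 u : (0 <= (f u * k (u - z))%:E)%E by rewrite lee_fin mulr_ge0.
have := iint_affine (2^-1 *: x) h0 mF F0.
rewrite ger0_norm ?invr_ge0// invrK => <-.
apply: eq_iint => x'; congr ((f _ * k _)%:E); first by rewrite scalerDr addrC.
have -> : z = 2^-1 *: (x - y) by rewrite xyz scalerA mulVf ?scale1r// pnatr_eq0.
by rewrite -scalerDr -scalerBr; congr (_ *: _); rewrite opprB addrCA addrK.
Qed.

Lemma sqrt_isqrt_le f k x y z : log_concave f -> log_concave k -> mrow f -> mrow k ->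
  x - y = 2 *: z ->
  ((Num.sqrt (f x * k y))%:E * isqrt f k <= (2 ^+ n)%:E * convr f k z)%E.
Proof.
move=> lf lk mf mk xyz.
have f0 u := log_concave_ge0 u lf; have k0 u := log_concave_ge0 u lk.
rewrite -(convr_midpoint mf mk f0 k0 xyz) /isqrt -iintZ; last 3 first.
- exact: mfun_isqrt.
- by move=> u; rewrite lee_fin sqrtr_ge0.
- by rewrite lee_fin sqrtr_ge0.
apply: le_iint => x'; rewrite -EFinM lee_fin; first by rewrite mulr_ge0 ?sqrtr_ge0.
exact: sqrt_mid_le.
Qed.

(** The geometric mean is at most [f + k]. *)
Lemma isqrt_lty f k : mrow f -> mrow k -> (forall x, 0 <= f x) -> (forall x, 0 <= k x) ->
  (integral_Rn f < +oo)%E -> (integral_Rn k < +oo)%E -> (isqrt f k < +oo)%E.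
Proof.
move=> mf mk f0 k0 If Ik.
apply: (@le_lt_trans _ _ (integral_Rn f + integral_Rn k)%E); last exact: lte_add_pinfty.
rewrite /integral_Rn -iintD; try (by exact: mfun_EFin); try by move=> x; rewrite lee_fin.
apply: le_iint => x; first by rewrite lee_fin sqrtr_ge0.
rewrite -EFinD lee_fin.
rewrite -[leRHS]ger0_norm ?addr_ge0// -sqrtr_sqr ler_sqrt ?sqr_ge0//.
have := f0 x; have := k0 x; nra.
Qed.

Lemma mrow_refl g : mrow g -> mrow (refl g).
Proof.
move=> mg; have := @mrow_affine _ (-1) 0 mg.
by congr mrow; apply/funext => u; rewrite scaleN1r addr0.
Qed.

Lemma integral_refl g : mrow g -> (forall x, 0 <= g x) ->
  integral_Rn (refl g) = integral_Rn g.
Proof.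
move=> mg g0; have h0 : -1 != 0 :> R by rewrite oppr_eq0 oner_eq0.
have := iint_affine 0 h0 (mfun_EFin mg); rewrite /integral_Rn.
rewrite normrN1 invr1 expr1n mul1e => <-; last by move=> x; rewrite lee_fin.
by apply: eq_iint => x; rewrite /refl scaleN1r addr0.
Qed.

Lemma iint_convr f g : mrow f -> mrow g -> (forall x, 0 <= f x) -> (forall x, 0 <= g x) ->
  iint (convr f (refl g)) = (integral_Rn f * integral_Rn g)%E.
Proof.
move=> mf mg f0 g0.
have mF := mfun2_convr mf (mrow_refl mg).
rewrite /convr (iint_swap mF); last by move=> x y; rewrite lee_fin mulr_ge0// g0.
rewrite [RHS]muleC /integral_Rn -iintZ; last 3 first.
- exact: mfun_EFin.
- by move=> x; rewrite lee_fin.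
- by apply: iint_ge0 => x; rewrite lee_fin.
apply: eq_iint => u; rewrite muleC.
have h0 : 1 != 0 :> R by rewrite oner_eq0.
have := iint_affine (- u) h0 (mfun_EFin mg).
rewrite normr1 invr1 expr1n mul1e => <-; last by move=> x; rewrite lee_fin.
rewrite -iintZ; last 3 first.
- by apply: mfun_EFin; exact: mrow_affine.
- by move=> x; rewrite lee_fin.
- by rewrite lee_fin.
apply: eq_iint => z; rewrite -EFinM /refl; congr ((_ * g _)%:E).
by rewrite opprB scale1r.
Qed.

Lemma lc_sum_ge0 f g z : (0 <= lc_sum f g z)%E.
Proof.
apply: (@le_trans _ _ (Num.sqrt (f (2 *: z) * g 0))%:E); first by rewrite lee_fin sqrtr_ge0.
by apply: ereal_sup_ubound; exists (2 *: z), 0; rewrite addr0.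
Qed.

Lemma le_lc_sum f g x y z : x - y = 2 *: z ->
  ((Num.sqrt (f x * refl g y))%:E <= lc_sum f g z)%E.
Proof. by move=> xyz; apply: ereal_sup_ubound; exists x, (- y). Qed.

Lemma lc_sum_le f g z (c : \bar R) :
  (forall x y, x - y = 2 *: z -> ((Num.sqrt (f x * refl g y))%:E <= c)%E) ->
  (lc_sum f g z <= c)%E.
Proof.
move=> H; apply: ge_ereal_sup => _ [x [y [xyz ->]]].
by rewrite -[y in g y]opprK; apply: (H x (- y)); rewrite opprK.
Qed.

(** The supremum is bounded after division by [isqrt], which therefore has to be finite; the value 0
    is treated apart. *)
Lemma lc_sum_isqrt_le f g z : log_concave f -> log_concave (refl g) ->
  mrow f -> mrow (refl g) -> (isqrt f (refl g) < +oo)%E ->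
  (lc_sum f g z * isqrt f (refl g) <= (2 ^+ n)%:E * convr f (refl g) z)%E.
Proof.
move=> lf lg mf mg; have := isqrt_ge0 f (refl g).
have H x y (xyz : x - y = 2 *: z) := sqrt_isqrt_le lf lg mf mg xyz.
case: (isqrt f (refl g)) H => [r| |]// H; rewrite lee_fin le_eqVlt => /orP[/eqP<-|r0] _.
  by rewrite mule0 mule_ge0 ?lee_fin ?exprn_ge0//; apply: convr_ge0 => x; exact: log_concave_ge0.
rewrite -lee_pdivlMr//; apply: lc_sum_le => x y xyz.
by rewrite lee_pdivlMr//; exact: H.
Qed.

Lemma log_concave_refl g : log_concave g -> log_concave (refl g).
Proof.
move=> [u [uNy [cu gE]]]; exists (u \o -%R); split=> [x|]; first exact: uNy.
split=> [x y r s t /= ux uy t01|x]; last exact: gE.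
by rewrite /= opprD -!scalerN; exact: cu.
Qed.

(** Monotonicity replaces [lc_sum] by a multiple of the measurable function [convr], and linearity
    of the integral is applied only to the latter. *)
Lemma rogers_shephard_le f g : log_concave f -> log_concave g -> mrow f -> mrow g ->
  (integral_Rn f < +oo)%E -> (integral_Rn g < +oo)%E ->
  (isqrt f (refl g) * iint (lc_sum f g) <= (2 ^+ n)%:E * integral_Rn f * integral_Rn g)%E.
Proof.
move=> lf lg mf mg If Ig.
have f0 u := log_concave_ge0 u lf; have g0 u := log_concave_ge0 u lg.
have lrg := log_concave_refl lg; have mrg := mrow_refl mg.
have rg0 u : 0 <= refl g u by exact: g0.
have Iy : (isqrt f (refl g) < +oo)%E by apply: isqrt_lty => //; rewrite integral_refl.
have H z := @lc_sum_isqrt_le f g z lf lrg mf mrg Iy.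
rewrite -muleA -(iint_convr mf mg f0 g0).
have c0 z : (0 <= convr f (refl g) z)%E by exact: convr_ge0.
have := isqrt_ge0 f (refl g).
case: (isqrt f (refl g)) Iy H => [r| |]// _ H; rewrite lee_fin le_eqVlt => /orP[/eqP<-|r0].
  by rewrite mul0e mule_ge0 ?lee_fin ?exprn_ge0//; exact: iint_ge0.
have two0 : (0 <= ((2 : R) ^+ n)%:E)%E by rewrite lee_fin exprn_ge0.
have mc : mfun (convr f (refl g)) by exact: mfun_convr.
rewrite -lee_pdivlMl// -iintZ// -iintZ//; first last.
- by rewrite lee_fin invr_ge0 ltW.
- by move=> x; rewrite mule_ge0.
- by move=> d T c cm; apply: measurable_funeM; exact: mc.
apply: le_iint => z; first exact: lc_sum_ge0.
by rewrite lee_pdivlMl// muleC.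
Qed.

End Inequality.

(** * Equality for simplicial cones *)

Section EqualityOfSimplicial.
Variables (R : realType) (n : nat).
Implicit Types (f g k : 'rV[R]_n -> R) (x y z : 'rV[R]_n).

Lemma supp_refl g x : supp (refl g) x <-> supp g (- x).
Proof.
suff H k z : supp k z -> supp (refl k) (- z).
  split=> [/H|/H]; last by rewrite opprK.
  by rewrite (_ : refl (refl g) = g)//; apply/funext => u; rewrite /refl opprK.
move=> Kz B nB.
have nB' : nbhs z (-%R @^-1` B).
  have c1 : continuous (fun u : 'rV[R]_n => - u).
    rewrite (_ : (fun u => - u) = fun u => -1 *: u + 0); first exact: continuous_affine.
    by apply/funext => u; rewrite scaleN1r addr0.
  exact: c1.
have [u [ku Bu]] := Kz _ nB'.
by exists (- u); split => //=; rewrite /refl opprK.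
Qed.

Lemma rogers_shephard_eq f g : log_concave f -> log_concave g -> mrow f -> mrow g ->
  (integral_Rn f < +oo)%E -> (integral_Rn g < +oo)%E ->
  (forall z, exists x y, x - y = 2 *: z /\ forall x',
     f (2^-1 *: (x + x')) * refl g (2^-1 *: (y + x')) =
     Num.sqrt (f x * refl g y) * Num.sqrt (f x' * refl g x')) ->
  (isqrt f (refl g) * iint (lc_sum f g) = (2 ^+ n)%:E * integral_Rn f * integral_Rn g)%E.
Proof.
move=> lf lg mf mg If Ig Hmax.
have f0 u := log_concave_ge0 u lf; have g0 u := log_concave_ge0 u lg.
have lrg := log_concave_refl lg; have mrg := mrow_refl mg.
have rg0 u : 0 <= refl g u by exact: g0.
have Iy : (isqrt f (refl g) < +oo)%E by apply: isqrt_lty => //; rewrite integral_refl.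
have c0 z : (0 <= convr f (refl g) z)%E by exact: convr_ge0.
have two0 : (0 <= ((2 : R) ^+ n)%:E)%E by rewrite lee_fin exprn_ge0.
have mc : mfun (convr f (refl g)) by exact: mfun_convr.
have H z : (lc_sum f g z * isqrt f (refl g) = (2 ^+ n)%:E * convr f (refl g) z)%E.
  apply/le_anti; rewrite lc_sum_isqrt_le//=.
  have [x [y [xyz xx']]] := Hmax z.
  rewrite -(convr_midpoint mf mrg f0 rg0 xyz).
  under eq_iint do rewrite xx' EFinM.
  rewrite iintZ; first by apply: lee_wpmul2r; [exact: isqrt_ge0|exact: le_lc_sum].
  - exact: mfun_isqrt.
  - by move=> u; rewrite lee_fin sqrtr_ge0.
  - by rewrite lee_fin sqrtr_ge0.
rewrite -muleA -(iint_convr mf mg f0 g0).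
have := isqrt_ge0 f (refl g).
case: (isqrt f (refl g)) Iy H => [r| |]// _ H; rewrite lee_fin le_eqVlt => /orP[/eqP r0|r0].
  rewrite -r0 mul0e -(iintZ mc c0 two0).
  rewrite -[LHS](_ : iint (fun _ : 'rV[R]_n => (0 * 0)%E) = 0%E); last first.
    by rewrite iintZ ?mul0e// => d T c cm; exact: measurable_cst.
  by apply: eq_iint => z; rewrite -H -r0 !mule0.
rewrite -(iintZ mc c0 two0) -(eq_iint H).
(* Here the pointwise identity [H] makes [lc_sum] measurable, as a multiple of [convr]. *)
have mh : mfun (lc_sum f g).
  move=> d T c cm.
  rewrite (_ : (fun t => _) = (fun t => (r^-1)%:E *
     ((2 ^+ n)%:E * convr f (refl g) (\row_i c i t)))%E).
    by apply: measurable_funeM; apply: measurable_funeM; exact: mc.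
  by apply/funext => t; rewrite -H muleCA -EFinM mulVf ?mule1// gt_eqF.
rewrite -iintZ//; last by rewrite lee_fin ltW.
  by apply: eq_iint => z; rewrite muleC.
by move=> z; exact: lc_sum_ge0.
Qed.

(** In the coordinates of [W], [w] and [w - z] are the positive and negative parts of [z]; the pair
    is [v + 2 *: w], [v + 2 *: (w - z)]. On [K] both logarithms are affine, so the midpoint estimate
    is an equality; for [x'] outside [K] both sides vanish. *)
Lemma simplicial_maximizer f k (W : 'M[R]_n) (v a b : 'rV[R]_n) (c1 c2 : R) :
  log_concave f -> log_concave k ->
  W \in unitmx ->
  let K := [set v + x | x in [set lam *m W | lam in
     [set lam : 'rV[R]_n | forall i, 0 <= lam ord0 i]]] in
  supp f = K -> supp k = K ->
  (forall x, K x -> f x = c1 * expR (- dotv a x)) ->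
  (forall x, K x -> k x = c2 * expR (dotv b x)) ->
  forall z, exists x y, x - y = 2 *: z /\ forall x',
     f (2^-1 *: (x + x')) * k (2^-1 *: (y + x')) =
     Num.sqrt (f x * k y) * Num.sqrt (f x' * k x').
Proof.
move=> lf lk uW K Kf Kk fE kE z.
have f0 u := log_concave_ge0 u lf; have k0 u := log_concave_ge0 u lk.
have KE x : K x <-> forall i, 0 <= ((x - v) *m invmx W) ord0 i.
  split=> [[_ [l l0 <-] <-] i|H]; first by rewrite addrC addKr mulmxK.
  exists (x - v); last by rewrite addrC subrK.
  by exists ((x - v) *m invmx W) => //; rewrite mulmxKV.
pose L := z *m invmx W.
pose w := (\row_i Num.max 0 (L ord0 i)) *m W.
have wE i : (w *m invmx W) ord0 i = Num.max 0 (L ord0 i) by rewrite mulmxK// mxE.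
have dotD (c x y : 'rV[R]_n) : dotv c (2^-1 *: (x + y)) = (dotv c x + dotv c y) / 2.
  rewrite /dotv -big_split mulr_suml; apply: eq_bigr => i _ /=.
  by rewrite !mxE; field.
exists (v + 2 *: w), (v + 2 *: w - 2 *: z); split; first by rewrite opprB addrCA subrr addr0.
set X := v + 2 *: w; set Y := X - 2 *: z => x'.
have KX : K X.
  apply/KE => i; rewrite /X addrC addKr -scalemxAl mxE wE.
  by rewrite mulr_ge0// le_max lexx.
have KY : K Y.
  apply/KE => i; have -> : Y - v = 2 *: (w - z) by apply/rowP => j; rewrite /Y /X !mxE; ring.
  rewrite -scalemxAl mulmxBl -/L mxE [X in _ * X]mxE wE [X in _ + X]mxE.
  by rewrite mulr_ge0// subr_ge0 le_max lexx orbT.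
have Kmid x y : K x -> K y -> K (2^-1 *: (x + y)).
  rewrite -Kf half_mid => Kx Ky; apply: supp_conv => //.
  by apply/andP; split; lra.
have [Kx'|nKx'] := pselect (K x').
  rewrite -sqrtrM ?mulr_ge0// mulrACA.
  have -> : f X * f x' = f (2^-1 *: (X + x')) ^+ 2.
    rewrite !fE//; last exact: Kmid.
    rewrite exprMn -expRM_natl dotD mulrACA -expRD -expr2; by congr (_ * expR _); field.
  have -> : k Y * k x' = k (2^-1 *: (Y + x')) ^+ 2.
    rewrite !kE//; last exact: Kmid.
    rewrite exprMn -expRM_natl dotD mulrACA -expRD -expr2; by congr (_ * expR _); field.
  by rewrite -exprMn sqrtr_sqr ger0_norm// mulr_ge0.
rewrite (nsupp_eq0 (f := f) (x := x')) ?Kf// mul0r sqrtr0 mulr0.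
have [fm|/nsupp_eq0->] := pselect (supp f (2^-1 *: (X + x'))); last by rewrite mul0r.
have [km|/nsupp_eq0->] := pselect (supp k (2^-1 *: (Y + x'))); last by rewrite mulr0.
(* In each coordinate one of [w], [w - z] is zero, so midpoints lying in both supports force the
   coordinates of [x' - v] to be non-negative. *)
exfalso; apply: nKx'; apply/KE => i.
move: fm km; rewrite Kf Kk => /KE/(_ i) fm /KE/(_ i) km; move: fm km.
have -> : 2^-1 *: (X + x') - v = w + 2^-1 *: (x' - v).
  by apply/rowP => j; rewrite !mxE; field.
have -> : 2^-1 *: (Y + x') - v = w - z + 2^-1 *: (x' - v).
  by apply/rowP => j; rewrite !mxE; field.
pose D : 'rV_n := (x' - v) *m invmx W.
have DE (A : 'rV[R]_n) : ((A + 2^-1 *: (x' - v)) *m invmx W) ord0 i =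
    (A *m invmx W) ord0 i + 2^-1 * D ord0 i.
  by rewrite mulmxDl -scalemxAl mxE; congr (_ + _); rewrite mxE.
rewrite !DE mulmxBl -/L; change (0 <= (w *m invmx W) ord0 i + 2^-1 * D ord0 i ->
  0 <= (w *m invmx W - L) ord0 i + 2^-1 * D ord0 i -> 0 <= D ord0 i).
have subE (A B : 'rV[R]_n) : (A - B) ord0 i = A ord0 i - B ord0 i by rewrite !mxE.
rewrite subE wE; case: (leP 0 (L ord0 i)) => ? ? ?; lra.
Qed.

End EqualityOfSimplicial.

(** * Decay of integrable log-concave functions *)

Section Decay.
Variables (R : realType) (n : nat).
Implicit Types (f g : 'rV[R]_n -> R) (x y z : 'rV[R]_n).

Lemma pos_ball f : log_concave f -> {within supp f, continuous f} ->
  interior (supp f) !=set0 ->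
  exists y (r m : R), [/\ 0 < r, 0 < m & forall p, ball y r p -> m <= f p].
Proof.
move=> lf cf [y iy].
have fy := interior_supp_gt0 lf cf iy.
have nb : nbhs (f y) [set s | f y / 2 < s] by apply: lt_nbhsr; lra.
have /nbhs_ballP[r r0 H] := continuous_interior cf iy nb.
by exists y, r, (f y / 2); split=> [//||p /H /ltW//]; lra.
Qed.

(* If [f >= e] at a point far from the ball around [y], the convex hull of that
   point and the ball contains many disjoint balls of a fixed radius. *)
Lemma superlevel_bounded f (e : R) : admissible f -> 0 < e ->
  exists y D, forall x, e <= f x -> ball y D x.
Proof.
move=> [lf If Kf cf] e0.
have f0 u := log_concave_ge0 u lf.
have [y [r [m [r0 m0 Hm]]]] := pos_ball lf cf Kf.
pose d := Num.min m e.
have d0 : 0 < d by rewrite lt_min m0 e0.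
have Ifge0 : (0 <= integral_Rn f)%E by apply: iint_ge0 => x; rewrite lee_fin.
have Ifin : integral_Rn f = (fine (integral_Rn f))%:E by rewrite fineK// ge0_fin_numE.
pose J := fine (integral_Rn f).
have dr0 : 0 < d * r ^+ n by rewrite mulr_gt0// exprn_gt0.
(* [N + 1] disjoint cubes of side [r] on which [f >= d] would carry more mass than [J]. *)
have [N NJ] : exists N : nat, J < N.+1%:R * (d * r ^+ n).
  by exists (Num.trunc (J / (d * r ^+ n))); rewrite -ltr_pdivrMr// truncnS_gt.
exists y, (2 * N.+1%:R * r) => x ex; apply/row_ballE.
have N0 : 0 < N.+1%:R :> R by rewrite ltr0n.
split; first by rewrite !mulr_gt0.
move=> i; rewrite ltNge; apply/negP => far.
(* The centres stay in the first half of the segment from [y] to [x], where contraction towards [x]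
   leaves a ball of radius at least [r / 2]. Consecutive centres differ by at least [r] in
   coordinate [i]. *)
pose t k : R := k%:R / (2 * N.+1%:R).
pose c k : 'rV[R]_n := (1 - t k) *: y + t k *: x.
have t01 k : (k < N.+1)%N -> 0 <= t k <= 2^-1.
  move=> kN; rewrite /t divr_ge0 ?mulr_ge0//= ler_pdivrMr ?mulr_gt0//.
  have -> : 2^-1 * (2 * N.+1%:R) = N.+1%:R :> R by rewrite mulKf// pnatr_eq0.
  by rewrite ler_nat; exact: ltnW.
have inside k (p : 'rV[R]_n) : (k < N.+1)%N -> ball (c k) (r / 2) p -> d <= f p.
  move=> /t01/andP[tk0 tk1] /row_ballE[_ Bp].
  pose q := y + (1 - t k)^-1 *: (p - c k).
  have s0 : 0 < 1 - t k by lra.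
  have -> : p = (1 - t k) *: q + t k *: x.
    rewrite /q scalerDr scalerA mulfV ?gt_eqF// scale1r addrAC.
    by rewrite -/(c k) addrC subrK.
  apply: log_concave_min => //; [|by rewrite (le_trans _ ex)// ge_min lexx orbT|lra].
  rewrite (@le_trans _ _ m) ?ge_min ?lexx//; apply: Hm; apply/row_ballE; split=> // j.
  have := Bp j; rewrite distrC => Bj.
  rewrite /q [X in _ - X]mxE opprD addrA subrr add0r normrN mxE normrM.
  rewrite [X in X * _]ger0_norm ?invr_ge0 1?ltW// mulrC ltr_pdivrMr//.
  rewrite [X in `|X|]mxE [X in `|_ + X|]mxE.
  by apply: lt_le_trans Bj _; nra.
have disj (p : 'rV[R]_n) (k l : 'I_N.+1) : ball (c k) (r / 2) p -> ball (c l) (r / 2) p -> k = l.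
  move=> /row_ballE[_ /(_ i) Bk] /row_ballE[_ /(_ i) Bl].
  apply/eqP/negPn/negP => kl.
  have kl1 : 1 <= `|k%:R - l%:R : R|.
    move: kl; rewrite neq_ltn => /orP[] kl.
      by rewrite distrC ger0_norm ?subr_ge0 ?ler_nat 1?ltnW// lerBrDl natr1 ler_nat.
    by rewrite ger0_norm ?subr_ge0 ?ler_nat 1?ltnW// lerBrDl natr1 ler_nat.
  have Ec : c k ord0 i - c l ord0 i = (k%:R - l%:R) * ((x ord0 i - y ord0 i) / (2 * N.+1%:R)).
    by rewrite /c /t !mxE; field; rewrite gt_eqF.
  have : `|c k ord0 i - c l ord0 i| < r.
    have -> : c k ord0 i - c l ord0 i =
      (c k ord0 i - p ord0 i) - (c l ord0 i - p ord0 i) by ring.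
    by apply: le_lt_trans (ler_normB _ _) _; lra.
  apply/negP; rewrite -leNgt Ec normrM.
  have : r <= `|(x ord0 i - y ord0 i) / (2 * N.+1%:R)|.
    rewrite normrM normfV [`|2 * _|]ger0_norm ?mulr_ge0// ler_pdivlMr ?mulr_gt0//.
    by rewrite distrC mulrC.
  by move: kl1; set A := `|_|; set B := `|_|; nra.
have [mS iS] := @iint_sum R n _ (index_enum 'I_N.+1) (fun k x => (bind (c k) (r / 2) x)%:E)
  (fun k => @mfun_bind _ _ _ _) (fun k x => bind_ge0 (c k) (r / 2) x).
have : (d%:E * (\sum_(k < N.+1) iint (fun x => (bind (c k) (r / 2) x)%:E)) <= J%:E)%E.
  rewrite -iS -iintZ//; last 2 first.
  - by move=> p; apply: sume_ge0 => k _; rewrite lee_fin bind_ge0.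
  - by rewrite lee_fin ltW.
  rewrite -Ifin; apply: le_iint => p.
    apply: mule_ge0; first by rewrite lee_fin ltW.
    by apply: sume_ge0 => k _; rewrite lee_fin bind_ge0.
  have [[k Bk]|nB] := pselect (exists k : 'I_N.+1, ball (c k) (r / 2) p); last first.
    rewrite big1 ?mule0 ?lee_fin// => k _; rewrite /bind indicE memNset// => Bk.
    by apply: nB; exists k.
  rewrite (bigD1 k)//= big1 ?adde0; last first.
    move=> l lk; rewrite /bind indicE memNset// => Bl.
    by move: lk; rewrite (disj p l k)// eqxx.
  by rewrite /bind indicE mem_set// mule1 lee_fin; exact: inside (ltn_ord k) Bk.
under eq_bigr do rewrite iint_bind ?divr_gt0//.
rewrite sumEFin big_const_ord iter_addr_0 -EFinM lee_fin leNgt.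
have -> : 2 * (r / 2) = r by field.
by rewrite -mulr_natl mulrCA NJ.
Qed.

Definition box y (D : R) : set 'rV[R]_n :=
  [set v | forall i, (`[(y ord0 i - D), (y ord0 i + D)]%classic : set R) (v ord0 i)].

Lemma compact_box y D : compact (box y D).
Proof.
apply: (@rV_compact R n (fun i => `[(y ord0 i - D), (y ord0 i + D)]%classic)) => i.
exact: segment_compact.
Qed.

Lemma ball_box y D : ball y D `<=` box y D.
Proof.
move=> x /row_ballE[_ H] i; have := H i; rewrite /= in_itv/= ltr_norml => /andP[h1 h2].
by apply/andP; split; lra.
Qed.

(** Off a compact box [f < 1]; on the box, the local bounds given by upper semicontinuity are made
    uniform by compactness. *)
Lemma lc_bounded f : admissible f -> exists2 M, 0 < M & forall x, f x <= M.
Proof.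
move=> af; have [lf _ _ cf] := af.
have [y [D HD]] := superlevel_bounded af ltr01.
have := (compact_near_coveringP _).1 (@compact_box y D) R (pinfty_nbhs R)
  (fun M x => f x < M) _.
case=> [x _|M0 [_ HM]].
  exists ([set x' | f x' < f x + 1], [set M | f x + 1 < M]).
    split; first by apply: (usc lf cf); lra.
    by exists (f x + 1); split; [exact: num_real|].
  by move=> [x' M] [/= h1 h2]; apply: lt_trans h2.
pose M := Num.max M0 1 + 1.
have M1 : M0 < M by rewrite /M; have : M0 <= Num.max M0 1 by [rewrite le_max lexx]; lra.
have M2 : 1 < M by rewrite /M; have : 1 <= Num.max M0 1 by [rewrite le_max lexx orbT]; lra.
exists M => [|x]; first lra.
have [/ltW fx|fx] := ltP (f x) 1; first lra.
by apply: ltW; apply: HM => //; apply: ball_box; exact: HD.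
Qed.

End Decay.

(** * Maximizers in the equality case *)

Section NearMaximizers.
Variables (R : realType) (n : nat).
Implicit Types (f g k : 'rV[R]_n -> R) (x y z : 'rV[R]_n).

(** Upper semicontinuity along a filter, with value [a]; this form composes with maps from product
    spaces. *)
Definition usc_at (T : Type) (F : set_system T) (p : T -> R) (a : R) :=
  forall a', a < a' -> \forall t \near F, p t < a'.

Lemma usc_atM (T : Type) (F : set_system T) (p q : T -> R) a b : Filter F ->
  (forall t, 0 <= p t) -> (forall t, 0 <= q t) -> 0 <= a -> 0 <= b ->
  usc_at F p a -> usc_at F q b -> usc_at F (fun t => p t * q t) (a * b).
Proof.
move=> FF p0 q0 a0 b0 up uq M abM.
(* As [e <= 1], the product of [a + e] and [b + e] is at most [a * b + e * (a + b + 1)], hence at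
   most [M]. *)
pose e := Num.min 1 ((M - a * b) / (a + b + 1)).
have e0 : 0 < e by rewrite lt_min ltr01 divr_gt0//; lra.
have e1 : e <= 1 by rewrite ge_min lexx.
have e2 : e * (a + b + 1) <= M - a * b.
  by rewrite -ler_pdivlMr; [rewrite ge_min lexx orbT|lra].
have h1 := up (a + e) _; have h2 := uq (b + e) _.
have {}h1 : \forall t \near F, p t < a + e by apply: h1; lra.
have {}h2 : \forall t \near F, q t < b + e by apply: h2; lra.
apply: filterS2 h1 h2 => t h1 h2.
have := p0 t; have := q0 t => q0t p0t.
have : p t * q t < (a + e) * (b + e) by apply: ltr_pM.
nra.
Qed.

Lemma usc_at_comp (T : topologicalType) f (h : T -> 'rV[R]_n) t :
  log_concave f -> {within supp f, continuous f} -> {for t, continuous h} ->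
  usc_at (nbhs t) (fun s => f (h s)) (f (h t)).
Proof. by move=> lf cf ch a' fa'; exact: (ch _ (usc lf cf fa')). Qed.

Lemma admissible_refl g : admissible g -> admissible (refl g).
Proof.
move=> [lg Ig [v iv] cg]; have mg := mrow_lc lg cg.
have cN : continuous (fun u : 'rV[R]_n => - u).
  rewrite (_ : (fun u => - u) = fun u => -1 *: u + 0); first exact: continuous_affine.
  by apply/funext => u; rewrite scaleN1r addr0.
split; first exact: log_concave_refl.
- by rewrite integral_refl// => x; exact: log_concave_ge0.
- exists (- v); have nb : nbhs (- - v) (supp g) by rewrite opprK.
  have nb' : nbhs (- v) [set u | supp g (- u)] := cN (- v) (supp g) nb.
  change (nbhs (- v) (supp (refl g))); apply: filterS nb' => x /= H; exact/supp_refl.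
apply/subspace_continuousP => x /supp_refl Kx B nB.
have /subspace_continuousP/(_ _ Kx) H := cg.
have nb : \forall u \near - x, supp g u -> B (g u) := H _ nB.
have nb' : \forall u \near x, supp g (- u) -> B (g (- u)) := cN x _ nb.
change (\forall u \near x, supp (refl g) u -> B (refl g u)).
by apply: filterS nb' => u /= Hu /supp_refl; exact: Hu.
Qed.

Lemma integral_gt0 f : admissible f -> (0 < integral_Rn f)%E.
Proof.
move=> [lf If Kf cf].
have [y [r [m [r0 m0 Hm]]]] := pos_ball lf cf Kf.
apply: (@lt_le_trans _ _ (m%:E * iint (fun x => (bind y r x)%:E))%E).
  by rewrite iint_bind// mule_gt0// lte_fin// exprn_gt0// mulr_gt0.
rewrite -iintZ//; last 3 first.
- exact: mfun_bind.
- by move=> x; rewrite lee_fin bind_ge0.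
- by rewrite lee_fin ltW.
apply: le_iint => x; rewrite -EFinM lee_fin ?mulr_ge0 ?bind_ge0 ?(ltW m0)//.
have [Bx|nBx] := pselect (ball y r x).
  by rewrite /bind indicE mem_set// mulr1; exact: Hm.
by rewrite /bind indicE memNset// mulr0; exact: log_concave_ge0.
Qed.

Lemma convr_lty f k z : admissible f -> admissible k -> (convr f k z < +oo)%E.
Proof.
move=> af ak; have [M M0 kM] := lc_bounded ak; have [lf If _ cf] := af.
have f0 u := log_concave_ge0 u lf.
have [lk _ _ _] := ak; have k0 u := log_concave_ge0 u lk.
apply: (@le_lt_trans _ _ (M%:E * integral_Rn f)%E); last first.
  by rewrite lte_mul_pinfty// ?lee_fin ltW.
rewrite /integral_Rn -iintZ; last 3 first.
- exact/mfun_EFin/mrow_lc.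
- by move=> x; rewrite lee_fin.
- by rewrite lee_fin ltW.
apply: le_iint => u; rewrite -?EFinM lee_fin ?mulr_ge0//.
by rewrite mulrC ler_wpM2r.
Qed.

Section Equality.
Variables (f g : 'rV[R]_n -> R).
Hypotheses (af : admissible f) (ag : admissible g).
Let k := refl g.
Hypothesis eqRS :
  (isqrt f k * iint (lc_sum f g) = (2 ^+ n)%:E * integral_Rn f * integral_Rn g)%E.

Let ak : admissible k := admissible_refl ag.
Let lf : log_concave f. Proof. by case: af. Qed.
Let lg : log_concave g. Proof. by case: ag. Qed.
Let lk : log_concave k. Proof. by case: ak. Qed.
Let cf : {within supp f, continuous f}. Proof. by case: af. Qed.
Let cg : {within supp g, continuous g}. Proof. by case: ag. Qed.
Let ck : {within supp k, continuous k}. Proof. by case: ak. Qed.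
Let mf : mrow f. Proof. exact: mrow_lc. Qed.
Let mg : mrow g. Proof. exact: mrow_lc. Qed.
Let mk : mrow k. Proof. exact: mrow_lc. Qed.
Let f0 x : 0 <= f x. Proof. exact: log_concave_ge0. Qed.
Let g0 x : 0 <= g x. Proof. exact: log_concave_ge0. Qed.
Let k0 x : 0 <= k x. Proof. exact: log_concave_ge0. Qed.
Let two0 : (0 <= ((2 : R) ^+ n)%:E)%E. Proof. by rewrite lee_fin exprn_ge0. Qed.

(** If [isqrt] vanished, equality would make the positive product of the integrals zero. *)
Lemma isqrt_pos_fin : exists2 r : R, 0 < r & isqrt f k = r%:E.
Proof.
have If : (integral_Rn f < +oo)%E by case: af.
have Ik : (integral_Rn k < +oo)%E by case: ak.
have := isqrt_lty mf mk f0 k0 If Ik; have := isqrt_ge0 f k; move: eqRS.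
case: (isqrt f k) => [r| |]// E; rewrite lee_fin le_eqVlt => /orP[/eqP r0|r0] _.
  exfalso; move: E; rewrite -r0 mul0e => E.
  have : (0 < (2 ^+ n)%:E * integral_Rn f * integral_Rn g)%E.
    by rewrite !mule_gt0 ?lte_fin ?exprn_gt0// integral_gt0.
  by rewrite -E ltxx.
by exists r.
Qed.

(** A deficit of at least [eta] on a whole cube of radius [rho] would lower the integral by [eta]
    times the volume of the cube, against [eqRS]. *)
Lemma near_equality (U : set 'rV[R]_n) z0 (eta : R) : nbhs z0 U -> 0 < eta ->
  exists2 z, U z & ~ (lc_sum f g z * isqrt f k + eta%:E <= (2 ^+ n)%:E * convr f k z)%E.
Proof.
move=> /nbhs_ballP[rho /= rho0 HU] eta0.
have [r r0 rE] := isqrt_pos_fin.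
apply: contrapT => nex.
have H z : U z -> (lc_sum f g z * r%:E + eta%:E <= (2 ^+ n)%:E * convr f k z)%E.
  by move=> Uz; apply: contrapT => h; apply: nex; exists z; rewrite ?rE.
have Iy : (isqrt f k < +oo)%E by rewrite rE ltry.
have Hall z := @lc_sum_isqrt_le R n f g z lf lk mf mk Iy; rewrite -/k rE in Hall.
have cfin z : ((2 ^+ n)%:E * convr f k z)%E \is a fin_num.
  by rewrite fin_numM// ge0_fin_numE ?convr_lty// convr_ge0.
pose c z := fine ((2 ^+ n)%:E * convr f k z)%E.
have cE z : ((2 ^+ n)%:E * convr f k z)%E = (c z)%:E by rewrite fineK.
(* A measurable majorant of [lc_sum * r]: the general bound, lowered by [eta] on the ball. *)
pose F z := (c z - eta * bind z0 rho z)%:E.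
have mconv : mfun (convr f k) by exact: mfun_convr.
have conv0 z : (0 <= convr f k z)%E by exact: convr_ge0.
have HF z : (lc_sum f g z * r%:E <= F z)%E.
  rewrite /F; have [Bz|nBz] := pselect (ball z0 rho z).
    rewrite /bind indicE mem_set// mulr1 EFinB leeBrDr//.
    by rewrite -cE; apply: H; exact: HU.
  by rewrite /bind indicE memNset// mulr0 subr0 -cE; exact: Hall.
have F0 z : (0 <= F z)%E.
  by apply: le_trans (HF z); rewrite mule_ge0 ?lc_sum_ge0// lee_fin ltW.
have mF : mfun F.
  move=> d T b mb.
  rewrite (_ : (fun t => _) = (fun t => (2 ^+ n)%:E * convr f k (\row_i b i t) -
      eta%:E * (bind z0 rho (\row_i b i t))%:E))%E; last first.
    by apply/funext => t; rewrite cE -EFinM -EFinB.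
  apply: emeasurable_funB; apply: measurable_funeM; first exact: mconv.
  exact: mfun_bind.
have mB : mfun (fun z => (eta%:E * (bind z0 rho z)%:E)%E).
  by move=> d T b mb; apply: measurable_funeM; exact: mfun_bind.
have B0 z : (0 <= eta%:E * (bind z0 rho z)%:E)%E.
  by rewrite -EFinM lee_fin mulr_ge0 ?bind_ge0// ltW.
have E1 : iint (fun z => ((2 ^+ n)%:E * convr f k z)%E) =
    (iint F + eta%:E * ((2 * rho) ^+ n)%:E)%E.
  rewrite -(@iint_bind R n z0)// -iintZ; last 3 first.
  - exact: mfun_bind.
  - by move=> z; rewrite lee_fin bind_ge0.
  - by rewrite lee_fin ltW.
  rewrite -iintD//; apply: eq_iint => z.
  by rewrite cE /F -EFinM -EFinD subrK.
have E2 : (r%:E * iint (lc_sum f g) = iint F + eta%:E * ((2 * rho) ^+ n)%:E)%E.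
  by rewrite -E1 iintZ// iint_convr// -rE eqRS muleA.
have E3 : (r%:E * iint (lc_sum f g) <= iint F)%E.
  rewrite -lee_pdivlMl// -iintZ//; last by rewrite lee_fin invr_ge0 ltW.
  apply: le_iint => z; first exact: lc_sum_ge0.
  by rewrite lee_pdivlMl// muleC.
have Ffin : iint F \is a fin_num.
  rewrite ge0_fin_numE; last exact: iint_ge0.
  apply: (@le_lt_trans _ _ (r%:E * iint (lc_sum f g))%E).
    by rewrite E2 leeDl// -EFinM lee_fin mulr_ge0 ?exprn_ge0 ?mulr_ge0// ltW.
  rewrite -rE eqRS; case: af => _ If _ _; case: ag => _ Ig _ _.
  rewrite lte_mul_pinfty//; last by rewrite fin_numM// ge0_fin_numE// iint_ge0// => x; rewrite lee_fin.
  by rewrite mule_ge0// iint_ge0// => x; rewrite lee_fin.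
move: E3; rewrite E2 -[leRHS]adde0 leeD2lE// -EFinM lee_fin leNgt.
by rewrite mulr_gt0// exprn_gt0// mulr_gt0.
Qed.

End Equality.
End NearMaximizers.

(** Equality is asked only at interior midpoints because the limit argument needs [f] and [k] to be
    continuous there. Positivity keeps [x] and [y] in the supports, possibly on their boundaries. *)
Definition maximizer (R : realType) (n : nat) (f k : 'rV[R]_n -> R) (x y : 'rV[R]_n) :=
  [/\ 0 < f x, 0 < k y & forall x',
  interior (supp f) (2^-1 *: (x + x')) -> interior (supp k) (2^-1 *: (y + x')) ->
  f (2^-1 *: (x + x')) * k (2^-1 *: (y + x')) =
  Num.sqrt (f x * k y) * Num.sqrt (f x' * k x')].

Section Maximizers.
Variables (R : realType) (n : nat).
Implicit Types (x y z : 'rV[R]_n).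
Variables (f g : 'rV[R]_n -> R).
Hypotheses (af : admissible f) (ag : admissible g).
Let k := refl g.
Hypothesis eqRS :
  (isqrt f k * iint (lc_sum f g) = (2 ^+ n)%:E * integral_Rn f * integral_Rn g)%E.

Let ak : admissible k := admissible_refl ag.
Let lf : log_concave f. Proof. by case: af. Qed.
Let lg : log_concave g. Proof. by case: ag. Qed.
Let lk : log_concave k. Proof. by case: ak. Qed.
Let cf : {within supp f, continuous f}. Proof. by case: af. Qed.
Let ck : {within supp k, continuous k}. Proof. by case: ak. Qed.
Let mf : mrow f. Proof. exact: mrow_lc. Qed.
Let mk : mrow k. Proof. exact: mrow_lc. Qed.
Let f0 x : 0 <= f x. Proof. exact: log_concave_ge0. Qed.
Let k0 x : 0 <= k x. Proof. exact: log_concave_ge0. Qed.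

Lemma near_maximizer (U : set 'rV[R]_n) z0 (eta r : R) :
  isqrt f k = r%:E -> 0 < r -> nbhs z0 U -> 0 < eta ->
  exists2 z, U z & exists x,
   ((2 ^+ n)%:E * convr f k z < (Num.sqrt (f x * k (x - 2 *: z)) * r + eta)%:E)%E.
Proof.
move=> rE r0 nU eta0; have [z Uz nle] := near_equality af ag eqRS nU eta0.
exists z => //; apply: contrapT => nex; apply: nle.
have cfin : ((2 ^+ n)%:E * convr f k z)%E \is a fin_num.
  by rewrite fin_numM// ge0_fin_numE ?convr_lty// convr_ge0.
rewrite -[refl g]/k rE -leeBrDr// -lee_pdivlMr//; apply: lc_sum_le => x y xyz.
rewrite lee_pdivlMr// leeBrDr// -EFinM -EFinD leNgt; apply/negP => h.
apply: nex; exists x; move: h.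
by rewrite (_ : x - 2 *: z = y)// -xyz opprB addrC subrK.
Qed.

(** This lower bound, uniform near [z0], keeps near-maximizers from escaping to infinity or to zeros
    of the product. *)
Lemma convr_lower_bound u0 z0 : interior (supp f) u0 -> interior (supp k) (u0 - z0) ->
  exists2 d : R, 0 < d & \forall z \near z0, (d%:E <= (2 ^+ n)%:E * convr f k z)%E.
Proof.
move=> iu iv.
have fu := interior_supp_gt0 lf cf iu; have kv := interior_supp_gt0 lk ck iv.
have nb1 : nbhs (f u0) [set s | f u0 / 2 < s] by apply: lt_nbhsr; lra.
have nb2 : nbhs (k (u0 - z0)) [set s | k (u0 - z0) / 2 < s] by apply: lt_nbhsr; lra.
have /nbhs_ballP[r1 /= r10 H1] := continuous_interior cf iu nb1.
have /nbhs_ballP[r2 /= r20 H2] := continuous_interior ck iv nb2.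
pose r := Num.min r1 r2.
have r0 : 0 < r by rewrite lt_min r10.
pose c := (f u0 / 2) * (k (u0 - z0) / 2).
have c0 : 0 < c by rewrite mulr_gt0// divr_gt0.
exists (2 ^+ n * (c * (2 * (r / 2)) ^+ n)).
  by rewrite !mulr_gt0 ?exprn_gt0 ?divr_gt0// mulr_gt0// divr_gt0.
apply/nbhs_ballP; exists (r / 2); first by rewrite /= divr_gt0.
move=> z /= Bz; rewrite EFinM lee_wpmul2l ?lee_fin ?exprn_ge0//.
rewrite EFinM -(@iint_bind R n u0) ?divr_gt0// -iintZ; last 3 first.
- exact: mfun_bind.
- by move=> u; rewrite lee_fin bind_ge0.
- by rewrite lee_fin ltW.
apply: le_iint => u; rewrite -EFinM lee_fin ?mulr_ge0 ?bind_ge0 ?(ltW c0)//.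
have [Bu|nBu] := pselect (ball u0 (r / 2) u); last first.
  by rewrite /bind indicE memNset// mulr0 mulr_ge0.
rewrite /bind indicE mem_set// mulr1 /c ler_pM ?divr_ge0//.
  apply/ltW/H1; apply: le_ball Bu.
  by rewrite (@le_trans _ _ r) ?ge_min ?lexx//; lra.
apply/ltW/H2; apply/row_ballE; split=> // i.
move: Bu Bz => /row_ballE[_ /(_ i) h1] /row_ballE[_ /(_ i) h2].
have rr2 : r <= r2 by rewrite ge_min lexx orbT.
apply: lt_le_trans rr2; rewrite !mxE.
rewrite (_ : _ - _ - _ = (u0 ord0 i - u ord0 i) - (z0 ord0 i - z ord0 i)); last by ring.
by apply: le_lt_trans (ler_normB _ _) _; rewrite (splitr r); exact: ltrD.
Qed.

Lemma lt_two_between (a b : R) : a < b ->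
  exists s t : R, [/\ a < s, s < t & t < b].
Proof. by move=> ab; exists ((2 * a + b) / 3), ((a + 2 * b) / 3); split; lra. Qed.

Lemma ler_gap (a b s t : R) : b < t -> s < a -> b - a + s <= t.
Proof. by move=> bt sa; lra. Qed.

(* A strict inequality in the midpoint estimate at one point x' persists on a
   ball around x', uniformly for nearby (x, z); integrating yields a gap. *)
Lemma strict_gap x z x' (r : R) : isqrt f k = r%:E ->
  let y := x - 2 *: z in
  interior (supp f) (2^-1 *: (x + x')) -> interior (supp k) (2^-1 *: (y + x')) ->
  Num.sqrt (f x * k y) * Num.sqrt (f x' * k x') <
    f (2^-1 *: (x + x')) * k (2^-1 *: (y + x')) ->
  exists2 eta : R, 0 < eta & \forall p \near (x, z),
    ((Num.sqrt (f p.1 * k (p.1 - 2 *: p.2)) * r + eta)%:E <= (2 ^+ n)%:E * convr f k p.2)%E.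
Proof.
move=> rE y im im' lt1.
set Rv := (X in X < _) in lt1; set Lv := (X in _ < X) in lt1.
have Rv0 : 0 <= Rv by rewrite mulr_ge0 ?sqrtr_ge0.
have [A [B [RvA AB BLv]]] := lt_two_between lt1.
pose T : topologicalType := ('rV[R]_n * 'rV[R]_n * 'rV[R]_n)%type.
pose t0 : T := ((x, z), x').
have cst1 (t : T) : (s.1.1 : 'rV[R]_n) @[s --> t] --> t.1.1.
  by apply: (cvg_comp fst fst); [exact: cvg_fst|exact: cvg_fst].
have cst2 (t : T) : (s.1.2 : 'rV[R]_n) @[s --> t] --> t.1.2.
  by apply: (cvg_comp fst snd); [exact: cvg_fst|exact: cvg_snd].
have cst3 (t : T) : (s.2 : 'rV[R]_n) @[s --> t] --> t.2 by exact: cvg_snd.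
have cZ (h : T -> 'rV[R]_n) t (a : R) : h s @[s --> t] --> h t -> a *: h s @[s --> t] --> a *: h t.
  move=> hc; have sc : a *: w @[w --> h t] --> a *: h t by exact: scaler_continuous.
  exact: (cvg_comp h (fun w => a *: w) hc sc).
have cy (t : T) : (s.1.1 - 2 *: s.1.2 : 'rV[R]_n) @[s --> t] --> t.1.1 - 2 *: t.1.2.
  exact: (cvgB (cst1 t) (cZ _ t 2 (cst2 t))).
have cm1 : (2^-1 *: (s.1.1 + s.2) : 'rV[R]_n) @[s --> t0] --> 2^-1 *: (x + x').
  exact: (cZ _ t0 2^-1 (cvgD (cst1 t0) (cst3 t0))).
have cm2 : (2^-1 *: (s.1.1 - 2 *: s.1.2 + s.2) : 'rV[R]_n) @[s --> t0] --> 2^-1 *: (y + x').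
  exact: (cZ _ t0 2^-1 (cvgD (cy t0) (cst3 t0))).
have nL : \forall t \near t0, B < f (2^-1 *: (t.1.1 + t.2)) * k (2^-1 *: (t.1.1 - 2 *: t.1.2 + t.2)).
  have cL1 : f (2^-1 *: (s.1.1 + s.2)) @[s --> t0] --> f (2^-1 *: (x + x')).
    by apply: (cvg_comp _ f cm1); exact: continuous_interior.
  have cL2 : k (2^-1 *: (s.1.1 - 2 *: s.1.2 + s.2)) @[s --> t0] --> k (2^-1 *: (y + x')).
    by apply: (cvg_comp _ k cm2); exact: continuous_interior.
  have nb : nbhs (Lv : R) [set s | B < s] by exact: lt_nbhsr.
  exact: (cvgM cL1 cL2 nb).
(* On this side [x], [y] and [x'] may be boundary points, so only upper semicontinuity is available;
   it is applied to the squared product and then carried through the roots. *)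
have nR : \forall t \near t0,
    Num.sqrt (f t.1.1 * k (t.1.1 - 2 *: t.1.2)) * Num.sqrt (f t.2 * k t.2) < A.
  have u1 : usc_at (nbhs t0) (fun t => f t.1.1 * k (t.1.1 - 2 *: t.1.2)) (f x * k y).
    apply: usc_atM => //; first exact: (usc_at_comp lf cf (cst1 t0)).
    exact: (usc_at_comp lk ck (cy t0)).
  have u2 : usc_at (nbhs t0) (fun t => f t.2 * k t.2) (f x' * k x').
    apply: usc_atM => //; first exact: (usc_at_comp lf cf (cst3 t0)).
    exact: (usc_at_comp lk ck (cst3 t0)).
  have u3 : usc_at (nbhs t0) (fun t => f t.1.1 * k (t.1.1 - 2 *: t.1.2) * (f t.2 * k t.2))
      (f x * k y * (f x' * k x')).
    by apply: usc_atM => // *; rewrite mulr_ge0.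
  have A0 : 0 <= A by apply: ltW; exact: le_lt_trans RvA.
  have sqE a b : 0 <= a -> 0 <= b -> (Num.sqrt a * Num.sqrt b < A) = (a * b < A ^+ 2).
    move=> a0 b0; rewrite -sqrtrM// -[A in LHS]ger0_norm// -sqrtr_sqr.
    case: (ltrP 0 (A ^+ 2)) => [A2|A2]; first by rewrite ltr_sqrt.
    by move: A2; rewrite leNgt exprn_gt0// (le_lt_trans Rv0).
  have : \forall t \near t0, f t.1.1 * k (t.1.1 - 2 *: t.1.2) * (f t.2 * k t.2) < A ^+ 2.
    by apply: u3; rewrite -sqE ?mulr_ge0.
  by apply: filterS => t; rewrite sqE ?mulr_ge0.
have [[U V] /= [nU nV] UV] : nbhs t0 [set t : T | B - A +
    Num.sqrt (f t.1.1 * k (t.1.1 - 2 *: t.1.2)) * Num.sqrt (f t.2 * k t.2) <=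
    f (2^-1 *: (t.1.1 + t.2)) * k (2^-1 *: (t.1.1 - 2 *: t.1.2 + t.2))].
  apply: filterS2 nL nR => t /= h1 h2.
  exact: ler_gap h1 h2.
have /nbhs_ballP[rho /= rho0 HV] := nV.
(* Height of the gap times the volume of the cube around [x']. *)
exists ((B - A) * (2 * rho) ^+ n); first by rewrite mulr_gt0 ?exprn_gt0 ?subr_gt0 ?mulr_gt0.
apply: filterS nU => -[x1 z1] /= Up.
rewrite -(@convr_midpoint R n f k x1 (x1 - 2 *: z1))//; last by rewrite opprB addrCA subrr addr0.
have s0 : (0 <= (Num.sqrt (f x1 * k (x1 - 2 *: z1)))%:E)%E by rewrite lee_fin sqrtr_ge0.
have q0 u : (0 <= (Num.sqrt (f u * k u))%:E)%E by rewrite lee_fin sqrtr_ge0.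
have b0 u : (0 <= (bind x' rho u)%:E)%E by rewrite lee_fin bind_ge0.
have BA0 : (0 <= (B - A)%:E)%E by rewrite lee_fin subr_ge0 ltW.
rewrite EFinD !EFinM -rE -(@iint_bind R n x')//.
rewrite -(iintZ (mfun_isqrt mf mk) q0 s0) -(iintZ (@mfun_bind _ _ x' rho) b0 BA0).
rewrite -iintD.
- apply: le_iint => u; first by rewrite adde_ge0// mule_ge0.
  rewrite -!EFinM -EFinD lee_fin.
  have [Bu|nBu] := pselect (ball x' rho u).
    rewrite /bind indicE mem_set// mulr1 addrC.
    exact: (UV ((x1, z1), u) (conj Up (HV _ Bu))).
  by rewrite /bind indicE memNset// mulr0 addr0; exact: sqrt_mid_le.
- by move=> d T' c cm; apply: measurable_funeM; exact: mfun_isqrt.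
- by move=> d T' c cm; apply: measurable_funeM; exact: mfun_bind.
- by move=> u; rewrite mule_ge0.
- by move=> u; rewrite mule_ge0.
Qed.

Lemma small_gap x z (r d : R) : 0 < r -> 0 < d -> f x * k (x - 2 *: z) = 0 ->
  \forall p \near (x, z), Num.sqrt (f p.1 * k (p.1 - 2 *: p.2)) * r <= d.
Proof.
move=> r0 d0 fk0.
have cst1 : (s.1 : 'rV[R]_n) @[s --> (x, z)] --> x by exact: cvg_fst.
have cy : (s.1 - 2 *: s.2 : 'rV[R]_n) @[s --> (x, z)] --> x - 2 *: z.
  have := @continuous_comb R n 1 (-2) 0 (x, z).
  rewrite (_ : (fun _ => _) = (fun s => s.1 - 2 *: s.2)).
    by rewrite /continuous_at /=.
  by apply/funext => s; rewrite scale1r addr0 scaleNr.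
have u1 : usc_at (nbhs (x, z)) (fun t => f t.1 * k (t.1 - 2 *: t.2)) (f x * k (x - 2 *: z)).
  apply: usc_atM => //; first exact: (usc_at_comp lf cf cst1).
  exact: (usc_at_comp lk ck cy).
have dr0 : 0 < d / r by rewrite divr_gt0.
have := u1 ((d / r) ^+ 2); rewrite fk0 => /(_ (exprn_gt0 _ dr0)).
apply: filterS => p lt1; rewrite -ler_pdivlMr//.
by rewrite -[leRHS]ger0_norm ?(ltW dr0)// -sqrtr_sqr ler_sqrt ?sqr_ge0// ltW.
Qed.

(** Without a maximizer at [z0], every [x] has a deficit persisting near [(x, z0)]: by [strict_gap],
    or by [small_gap] where the product vanishes. Compactness makes it uniform over a box, and
    beyond the box the product is too small. A deficit for all [z] near [z0] contradicts
    [near_maximizer]. *)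
Lemma exists_maximizer u0 z0 : interior (supp f) u0 -> interior (supp k) (u0 - z0) ->
  exists x y, x - y = 2 *: z0 /\ maximizer f k x y.
Proof.
move=> iu iv; apply: contrapT => nex.
have [r r0 rE] := isqrt_pos_fin af ag eqRS.
have [d d0 Hd] := convr_lower_bound iu iv.
have [M M0 kM] := lc_bounded ak.
(* Chosen so that [Num.sqrt (e * M) * r = d / 2]. *)
pose e := (d / 2 / r) ^+ 2 / M.
have dr0 : 0 < d / 2 / r by rewrite !divr_gt0.
have e0 : 0 < e by rewrite divr_gt0// exprn_gt0.
have [y0 [D HD]] := superlevel_bounded af e0.
have far x z : ~ box y0 D x -> Num.sqrt (f x * k (x - 2 *: z)) * r <= d / 2.
  move=> nB; rewrite -ler_pdivlMr//.
  rewrite -[leRHS]ger0_norm ?(ltW dr0)// -sqrtr_sqr ler_sqrt ?sqr_ge0//.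
  have fe : f x <= e by rewrite leNgt; apply/negP => /ltW/HD/ball_box.
  apply: (@le_trans _ _ (e * M)); first exact: ler_pM.
  by rewrite /e divfK// gt_eqF.
pose P (q : 'rV[R]_n * R) x :=
  ((Num.sqrt (f x * k (x - 2 *: q.1)) * r + q.2)%:E <= (2 ^+ n)%:E * convr f k q.1)%E.
have d2 : 0 < d / 2 by rewrite divr_gt0.
have cover x eta : 0 < eta -> (\forall p \near (x, z0),
    ((Num.sqrt (f p.1 * k (p.1 - 2 *: p.2)) * r + eta)%:E <= (2 ^+ n)%:E * convr f k p.2)%E) ->
    filter_prod (nbhs x) (filter_prod (nbhs z0) ((0:R)^'+)) (fun p => P p.2 p.1).
  move=> eta0 [[U V] /= [nU nV] UV].
  exists (U, [set q | V q.1 /\ q.2 <= eta]).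
    split=> //=; exists (V, [set s | s <= eta]); last by move=> [z s] [].
    by split=> //=; exact: nbhs_right_le.
  move=> [x1 [z1 s]] /= [Ux1 [Vz1 seta]]; apply: le_trans (UV (x1, z1) (conj Ux1 Vz1)).
  by rewrite lee_fin lerD2l.
(* A smaller deficit is a weaker claim, so covering along the filter of [z] near [z0] and small
   positive deficits yields a common one. *)
have nc : near_covering (box y0 D) by apply/compact_near_coveringP; exact: compact_box.
have [x Bx|[U V] /= [nU nV] UV] := nc _ (filter_prod (nbhs z0) ((0:R)^'+)) P _.
  pose y := x - 2 *: z0.
  have [fk0|fk0] := eqVneq (f x * k y) 0.
    apply: (cover x (d / 2)) => //.
    have [[U V] /= [nU nV] UV] := small_gap r0 d2 fk0.
    exists (U, V `&` [set z | (d%:E <= (2 ^+ n)%:E * convr f k z)%E]).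
      by split=> //=; exact: filterI.
    move=> [x1 z1] /= [Ux1 [Vz1 dz1]]; apply: le_trans dz1; rewrite lee_fin.
    by rewrite [leRHS](splitr d) lerD2r; exact: (UV (x1, z1) (conj Ux1 Vz1)).
  have [x' [im im' lt1]] : exists x', [/\ interior (supp f) (2^-1 *: (x + x')),
      interior (supp k) (2^-1 *: (y + x')) &
      Num.sqrt (f x * k y) * Num.sqrt (f x' * k x') <
      f (2^-1 *: (x + x')) * k (2^-1 *: (y + x'))].
    apply: contrapT => nx'; apply: nex; exists x, y; split.
      by rewrite /y opprB addrCA subrr addr0.
    move: fk0; rewrite mulf_eq0 negb_or => /andP[fx ky].
    split; [by rewrite lt_def fx f0|by rewrite lt_def ky k0|].
    move=> x' im im'; apply/eqP; rewrite eq_sym eq_le sqrt_mid_le//=.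
    by rewrite leNgt; apply/negP => lt1; apply: nx'; exists x'.
  have [eta eta0 Heta] := strict_gap rE im im' lt1.
  exact: cover eta0 Heta.
have [eta [Veta [eta0 eta1]]] : exists eta, V eta /\ (0 < eta /\ eta <= d / 2).
  have : ((0:R)^'+) (V `&` ([set s | 0 < s] `&` [set s | s <= d / 2])).
    apply: filterI => //; apply: filterI; first exact: nbhs_right_gt.
    exact: nbhs_right_le.
  by move=> /filter_ex.
have [z [Uz dz] [x]] := near_maximizer rE r0 (filterI nU Hd) eta0.
have [Bx|nBx] := pselect (box y0 D x).
  by apply/negP; rewrite -leNgt; exact: (UV (z, eta) (conj Uz Veta) x Bx).
apply/negP; rewrite -leNgt; apply: le_trans dz; rewrite lee_fin (splitr d).
by apply: lerD => //; exact: far.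
Qed.

End Maximizers.

(** * Lattice cones are simplicial *)

Ltac vring := apply/rowP => ?; rewrite !mxE; ring.

Section LatticeCone.
Variables (R : realType) (n : nat).
Implicit Types (x y z v w : 'rV[R]_n).
Variable Cl : set 'rV[R]_n.
Hypothesis C0 : Cl 0.
Hypothesis CD : forall x y, Cl x -> Cl y -> Cl (x + y).
Hypothesis CZ : forall (t : R) x, 0 <= t -> Cl x -> Cl (t *: x).
Hypothesis Cpt : forall x, Cl x -> Cl (- x) -> x = 0.
Hypothesis Carch : forall x y, (forall e : R, 0 < e -> Cl (x + e *: y)) -> Cl x.
(** In the order with positive cone [Cl], [p] is the join of 0 and [z]. *)
Hypothesis Cjoin : forall z, exists p, forall x, (Cl x /\ Cl (x - z)) <-> Cl (x - p).

(** Lattice disjointness: the meet is 0, expressed through positive lower bounds. *)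
Definition disj x y := forall v, Cl v -> Cl (x - v) -> Cl (y - v) -> v = 0.

Lemma disjC x y : disj x y -> disj y x.
Proof. by move=> H v v0 yv xv; exact: H. Qed.

Lemma disj_le x y y' : disj x y -> Cl (y - y') -> disj x y'.
Proof.
move=> H yy' v v0 xv yv; apply: H => //.
by rewrite -(subrK y' y) -addrA; exact: CD.
Qed.

Lemma joinP z : exists p, [/\ Cl p, Cl (p - z) & forall x, Cl x -> Cl (x - z) -> Cl (x - p)].
Proof.
have [p Hp] := Cjoin z; exists p.
have [H1 H2] : Cl p /\ Cl (p - z) by apply/Hp; rewrite subrr.
by split=> // x Cx Cxz; apply/Hp.
Qed.

(** [p] and [p - z] are the positive and negative parts of [z]. Removing a common lower bound [v]
    from [p] leaves an upper bound of 0 and [z], so leastness of [p] puts [- v] in the cone. *)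
Lemma join_disj z p : Cl p -> Cl (p - z) ->
  (forall x, Cl x -> Cl (x - z) -> Cl (x - p)) -> disj p (p - z).
Proof.
move=> Cp Cpz Hp v v0 pv pzv; apply: Cpt => //.
have := Hp (p - v) pv; rewrite (_ : p - v - p = - v); last by rewrite addrAC subrr add0r.
by apply; rewrite addrAC.
Qed.

(** Riesz decomposition: [v2] is the positive part of [v - y], the least portion that [w] has to
    absorb. *)
Lemma riesz v y w : Cl v -> Cl y -> Cl w -> Cl (y + w - v) ->
  exists v1 v2, [/\ v = v1 + v2, Cl v1, Cl (y - v1), Cl v2 & Cl (w - v2)].
Proof.
move=> Cv Cy Cw Cyw; have [p [Cp Cpz Hp]] := joinP (v - y).
exists (v - p), p; rewrite subrK; split=> //.
- by apply: Hp => //; rewrite opprB addrCA subrr addr0.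
- by rewrite (_ : y - (v - p) = p - (v - y)); [|vring].
- by apply: Hp => //; rewrite opprB addrA [w + y]addrC.
Qed.

Lemma disjD x y w : Cl y -> Cl w -> disj x y -> disj x w -> disj x (y + w).
Proof.
move=> Cy Cw xy xw v Cv xv ywv.
have [v1 [v2 [vE C1 yv1 C2 wv2]]] := riesz Cv Cy Cw ywv.
have v10 : v1 = 0.
  apply: xy => //; rewrite (_ : x - v1 = (x - v) + v2); first exact: CD.
  by rewrite vE; vring.
have v20 : v2 = 0.
  apply: xw => //; rewrite (_ : x - v2 = (x - v) + v1); first exact: CD.
  by rewrite vE; vring.
by rewrite vE v10 v20 addr0.
Qed.

Lemma disjZ x y (t : R) : 0 <= t -> Cl y -> disj x y -> disj x (t *: y).
Proof.
move=> t0 Cy xy v Cv xv tyv.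
(* [s] is at least both [t] and 1, so [s^-1 *: v] lies below [y] and below [x]. *)
pose s := t + 1; have s0 : 0 < s by rewrite /s; lra.
have : s^-1 *: v = 0.
  apply: xy; first by apply: CZ => //; rewrite invr_ge0 ltW.
    rewrite (_ : x - s^-1 *: v = (x - v) + (1 - s^-1) *: v).
      by apply: CD => //; apply: CZ => //; rewrite subr_ge0 invf_le1// /s; lra.
    by rewrite scalerBl scale1r addrA subrK.
  rewrite (_ : y - s^-1 *: v = s^-1 *: ((t *: y - v) + y)).
    by apply: CZ; [rewrite invr_ge0 ltW|exact: CD].
  rewrite addrAC -[X in _ + X - _]scale1r -scalerDl scalerBr scalerA mulVf ?gt_eqF//.
  by rewrite scale1r.
by move/eqP; rewrite scaler_eq0 invr_eq0 gt_eqF//= => /eqP.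
Qed.

Lemma disj0 x : disj x 0.
Proof. by move=> v Cv _; rewrite sub0r; exact: Cpt. Qed.

Lemma disj_sum (I : Type) (s : seq I) (P : pred I) (F : I -> 'rV[R]_n) x :
  (forall i, P i -> Cl (F i)) -> (forall i, P i -> disj x (F i)) ->
  disj x (\sum_(i <- s | P i) F i).
Proof.
move=> CF dF.
suff [_] : Cl (\sum_(i <- s | P i) F i) /\ disj x (\sum_(i <- s | P i) F i) by [].
elim/big_rec : _ => [|i y Pi [Cy dy]]; first by split=> //; exact: disj0.
by split; [apply: CD => //; exact: CF|apply: disjD => //; [exact: CF|exact: dF]].
Qed.

Lemma cone_sum (I : Type) (s : seq I) (P : pred I) (F : I -> 'rV[R]_n) :
  (forall i, P i -> Cl (F i)) -> Cl (\sum_(i <- s | P i) F i).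
Proof. by move=> CF; elim/big_ind : _. Qed.

Definition fam m (e : 'I_m -> 'rV[R]_n) := (forall i, Cl (e i) /\ e i != 0) /\
  forall i j, i != j -> disj (e i) (e j).

Lemma fam_free m (e : 'I_m -> 'rV[R]_n) : fam e -> row_free (\matrix_i e i).
Proof.
move=> [Ce de]; apply: inj_row_free => lam; rewrite mulmx_sum_row => lam0.
have split_sum (P : pred 'I_m) : \sum_(i | P i) lam ord0 i *: e i =
    \sum_(i | ~~ P i) - lam ord0 i *: e i.
  apply/eqP; rewrite -subr_eq0 -sumrN; apply/eqP; rewrite -[RHS]lam0 [RHS](bigID P)/=.
  by congr (_ + _); apply: eq_bigr => i _; rewrite rowK// scaleNr opprK.
(* The positive and the negative part of a relation are equal, yet disjoint
   from one another. *)
have key i : 0 < lam ord0 i -> False.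
  move=> li; have [Ci /eqP ei0] := Ce i.
  have E := split_sum (fun j => 0 < lam ord0 j).
  apply: ei0; apply: (scalerI (a := lam ord0 i)); first by rewrite gt_eqF.
  rewrite scaler0.
  have dd : disj (lam ord0 i *: e i) (\sum_(j | ~~ (0 < lam ord0 j)) - lam ord0 j *: e j).
    apply: disj_sum => j; rewrite -leNgt => lj.
      by apply: CZ; [rewrite oppr_ge0|case: (Ce j)].
    apply: disjZ; [by rewrite oppr_ge0|by case: (Ce j)|].
    apply: disjC; apply: disjZ; [exact: ltW|by case: (Ce i)|].
    by apply: de; apply/eqP => ji; move: lj; rewrite ji leNgt li.
  apply: dd; [by apply: CZ => //; exact: ltW|by rewrite subrr|].
  rewrite -E (bigD1 i)//= addrAC subrr add0r; apply: cone_sum => j /andP[lj _].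
  by apply: CZ; [exact: ltW|case: (Ce j)].
have key' i : lam ord0 i < 0 -> False.
  move=> li; have [Ci /eqP ei0] := Ce i.
  have E := split_sum (fun j => 0 <= lam ord0 j).
  apply: ei0; apply: (scalerI (a := - lam ord0 i)); first by rewrite oppr_eq0 lt_eqF.
  rewrite scaler0.
  have dd : disj (- lam ord0 i *: e i) (\sum_(j | 0 <= lam ord0 j) lam ord0 j *: e j).
    apply: disj_sum => j lj; first by apply: CZ => //; case: (Ce j).
    apply: disjZ => //; first by case: (Ce j).
    apply: disjC; apply: disjZ; [by rewrite oppr_ge0 ltW|by case: (Ce i)|].
    by apply: de; apply/eqP => ji; move: lj; rewrite ji leNgt li.
  apply: dd; [by apply: CZ => //; rewrite oppr_ge0 ltW|by rewrite subrr|].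
  rewrite E (bigD1 i) -?ltNge//= addrAC subrr add0r.
  apply: cone_sum => j /andP[]; rewrite -ltNge => lj _.
  by apply: CZ; [rewrite oppr_ge0 ltW|case: (Ce j)].
apply/rowP => i; rewrite mxE; case: (ltrgt0P (lam ord0 i)) => // li; exfalso.
  exact: key li.
exact: key' li.
Qed.

Lemma fam_card m (e : 'I_m -> 'rV[R]_n) : fam e -> (m <= n)%N.
Proof. by move=> /fam_free /eqP <-; exact: rank_leq_col. Qed.

Lemma fam_ext m (e : 'I_m -> 'rV[R]_n) b : fam e -> Cl b -> b != 0 ->
  (forall i, disj b (e i)) -> exists e' : 'I_m.+1 -> 'rV[R]_n, fam e'.
Proof.
move=> [Ce de] Cb b0 db.
exists (fun i => if unlift ord_max i is Some j then e j else b); split=> [i|i j].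
  by case: unliftP.
case: unliftP => [i' ->|->]; case: unliftP => [j' ->|->]; rewrite ?eqxx// => ij.
- by apply: de; apply: contra_neq ij => ->.
- exact: disjC.
Qed.

Lemma fam_set m (e : 'I_m -> 'rV[R]_n) i0 a : fam e -> Cl a -> a != 0 ->
  (forall i, i != i0 -> disj a (e i)) -> fam (fun i => if i == i0 then a else e i).
Proof.
move=> [Ce de] Ca a0 da; split=> [i|i j]; first by case: ifP.
case: (eqVneq i i0) => [Ei|ii0]; case: (eqVneq j i0) => [Ej|ji0] => ij.
- by rewrite Ei Ej eqxx in ij.
- exact: da.
- by apply: disjC; exact: da.
- exact: de.
Qed.

Lemma maximal_fam : exists m (e : 'I_m -> 'rV[R]_n), fam e /\
  forall e' : 'I_m.+1 -> 'rV[R]_n, ~ fam e'.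
Proof.
pose P m := `[< exists e : 'I_m -> 'rV[R]_n, fam e >].
have ord0P (i : 'I_0) : False by case: i.
have exP : exists m, P m.
  by exists 0%N; apply/asboolP; exists (fun _ => 0); split=> [i|i j]; case: (ord0P i).
have ubP m : P m -> (m <= n)%N by move=> /asboolP[e /fam_card].
case: (ex_maxnP exP ubP) => m /asboolP[e fe] Hm.
exists m, e; split=> // e' fe'.
have : P m.+1 by apply/asboolP; exists e'.
by move=> /Hm; rewrite ltnn.
Qed.

(** The Archimedean property enters twice: unbounded multiples of [e] below [x] would put [- e] in
    the cone, and the supremum of the multiples is attained. *)
Lemma le_scale_sup e x : Cl e -> e != 0 -> Cl x -> exists t : R,
  [/\ 0 <= t, Cl (x - t *: e) & forall s, Cl (x - s *: e) -> s <= t].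
Proof.
move=> Ce e0 Cx.
have [M HM] : exists M : R, forall s, Cl (x - s *: e) -> s <= M.
  apply: contrapT => nM; move/eqP: e0; apply; apply: Cpt => //.
  apply: (@Carch _ x) => eps eps0.
  have [s [Cs sM]] : exists s, Cl (x - s *: e) /\ eps^-1 < s.
    apply: contrapT => ns; apply: nM; exists eps^-1 => s Cs.
    by rewrite leNgt; apply/negP => h; apply: ns; exists s.
  have s0 : 0 < s by apply: lt_trans sM; rewrite invr_gt0.
  rewrite (_ : - e + eps *: x = eps *: (x - s *: e) + (eps * s - 1) *: e).
    apply: CD; apply: CZ => //; first exact: ltW.
    by rewrite subr_ge0 mulrC -ler_pdivrMr// mul1r ltW.
  by rewrite scalerBr scalerA scalerBl scale1r addrA subrK addrC.
pose S : set R := [set s | Cl (x - s *: e)].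
have S0 : S 0 by rewrite /S/= scale0r subr0.
have hS : has_sup S by split; [exists 0|exists M => s; exact: HM].
exists (sup S); split.
- exact: sup_upper_bound.
- apply: (@Carch _ e) => eps eps0.
  have [s Ss ls] := sup_adherent eps0 hS.
  rewrite (_ : _ + _ = (x - s *: e) + (s - sup S + eps) *: e).
    by apply: CD => //; apply: CZ => //; lra.
  by move: (sup S) => T; vring.
- by move=> s Ss; exact: sup_upper_bound.
Qed.

Section Maximal.
Variables (m : nat) (e : 'I_m -> 'rV[R]_n).
Hypothesis fe : fam e.
Hypothesis emax : forall e' : 'I_m.+1 -> 'rV[R]_n, ~ fam e'.

(** Maximality makes [e i] an atom. If both parts of [x - t *: e i] were non-zero, they would be
    disjoint from each other and, lying below multiples of [e i], from the other members; replacing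
    [e i] by the two would enlarge the family. *)
Lemma atom_total i x (t : R) : Cl x -> Cl (e i - x) -> Cl (t *: e i - x) \/ Cl (x - t *: e i).
Proof.
move=> Cx xe; have [Ce de] := fe; have [Ci ei0] := Ce i.
have [p [Cp Cpz Hp]] := joinP (x - t *: e i).
have dp := join_disj Cp Cpz Hp.
pose b := p - (x - t *: e i).
have [p0|p0] := eqVneq p 0; first by left; move: Cpz; rewrite p0 sub0r opprB.
have [b0|b0] := eqVneq b 0; first by right; move/eqP: b0; rewrite /b subr_eq0 => /eqP <-.
exfalso.
pose M := 1 + `|t|.
have tM : 0 <= t + `|t| by rewrite -lerBlDl sub0r -normrN ler_norm.
have tM' : 0 <= `|t| - t by rewrite subr_ge0 ler_norm.
have pM : Cl (M *: e i - p).
  apply: Hp; first by apply: CZ => //; rewrite /M addr_ge0.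
  rewrite (_ : _ - _ = (e i - x) + (t + `|t|) *: e i); first by apply: CD => //; exact: CZ.
  by rewrite /M !scalerDl scale1r; apply/rowP => j; rewrite !mxE; ring.
have bM : Cl ((M + `|t|) *: e i - b).
  rewrite (_ : _ - b = (M *: e i - p) + (x + (`|t| - t) *: e i)).
    by apply: CD => //; apply: CD => //; exact: CZ.
  by rewrite /b; apply/rowP => j; rewrite !mxE; ring.
have da j : j != i -> disj p (e j).
  move=> ji; apply: disjC; apply: disj_le pM; apply: disjZ => //; last exact: de.
  by rewrite /M addr_ge0.
have db j : j != i -> disj b (e j).
  move=> ji; apply: disjC; apply: disj_le bM; apply: disjZ => //; last exact: de.
  by rewrite /M !addr_ge0.
have [|e' fe'] := fam_ext (fam_set fe Cp p0 da) Cpz b0; last exact: emax fe'.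
by move=> j; case: eqVneq => [_|ji]; [exact: disjC|exact: db].
Qed.

(** For the largest [t] with [t *: e i] below [x], comparability puts [x] below [(t + eps) *: e i]
    for every [eps > 0]. *)
Lemma atom_multiple i x : Cl x -> Cl (e i - x) -> exists t : R, x = t *: e i.
Proof.
move=> Cx xe; have [Ce de] := fe; have [Ci ei0] := Ce i.
have [t [t0 xt Ht]] := le_scale_sup Ci ei0 Cx.
exists t; apply/eqP; rewrite -subr_eq0; apply/eqP; apply: Cpt => //; rewrite opprB.
apply: (@Carch _ (e i)) => eps eps0.
have [|h] := atom_total (t + eps) Cx xe; first by rewrite scalerDl addrAC.
by have := Ht _ h; lra.
Qed.

Lemma atom_residual i x : Cl x -> exists2 t : R, 0 <= t &
  Cl (x - t *: e i) /\ disj (x - t *: e i) (e i).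
Proof.
move=> Cx; have [Ce de] := fe; have [Ci ei0] := Ce i.
have [t [t0 xt Ht]] := le_scale_sup Ci ei0 Cx.
exists t => //; split=> // v Cv xv ev.
have [s vE] := atom_multiple Cv ev.
have s0 : s <= 0.
  rewrite -(lerD2l t) addr0; apply: Ht.
  by rewrite scalerDl opprD addrA -vE.
apply: Cpt => //; rewrite vE -scaleNr; apply: CZ => //; by rewrite oppr_ge0.
Qed.

(** Multiples of the [e i] are subtracted in turn; residuals only decrease, so disjointness once
    reached persists. A non-zero final residual would extend the family. *)
Lemma cone_combination x : Cl x ->
  exists2 lam : 'rV[R]_m, (forall i, 0 <= lam ord0 i) & x = lam *m (\matrix_i e i).
Proof.
move=> Cx; have [Ce de] := fe.
have H j : (j <= m)%N -> exists2 lam : 'rV[R]_m, (forall i, 0 <= lam ord0 i) &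
    Cl (x - lam *m (\matrix_i e i)) /\
    forall i : 'I_m, (i < j)%N -> disj (x - lam *m (\matrix_i e i)) (e i).
  elim: j => [_|j IH jm].
    by exists 0 => [i|]; [rewrite mxE|rewrite mul0mx subr0].
  have [lam l0 [Cr dr]] := IH (ltnW jm).
  pose i0 := Ordinal jm.
  have [t t0 [Ct dt]] := atom_residual i0 Cr.
  have E : x - (lam + t *: delta_mx 0 i0) *m (\matrix_i e i) =
      x - lam *m (\matrix_i e i) - t *: e i0.
    by rewrite mulmxDl -scalemxAl -rowE rowK opprD addrA.
  exists (lam + t *: delta_mx 0 i0) => [i|].
    by rewrite !mxE addr_ge0// mulr_ge0.
  rewrite E; split=> // i; rewrite ltnS leq_eqVlt => /orP[/eqP ij|ij].
    by rewrite (_ : i = i0)//; exact: val_inj.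
  apply: disjC; apply: disj_le (disjC (dr i ij)) _.
  by rewrite opprB addrCA subrr addr0; apply: CZ => //; case: (Ce i0).
have [lam l0 [Cr dr]] := H m (leqnn m).
exists lam => //; apply/eqP; rewrite -subr_eq0; apply/negPn/negP => r0.
have [|e' fe'] := fam_ext fe Cr r0; last exact: emax fe'.
by move=> i; apply: dr.
Qed.

End Maximal.

(* A finite-dimensional Archimedean vector lattice is a product of lines:
   a maximal family of pairwise disjoint positive elements is a basis. *)
Theorem lattice_cone_simplicial : simplicial_cone Cl.
Proof.
have [m [e [fe emax]]] := maximal_fam.
have ffree := fam_free fe.
have comb := cone_combination fe emax.
(* The cone spans the space: [z] is the difference of its positive and negative parts. *)
have ffull : row_full (\matrix_i e i).
  rewrite -sub1mx; apply/rV_subP => z _.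
  have [p [Cp Cpz _]] := joinP z.
  have [l1 _ E1] := comb _ Cp; have [l2 _ E2] := comb _ Cpz.
  rewrite (_ : z = (l1 - l2) *m (\matrix_i e i)) ?submxMl//.
  by rewrite mulmxBl -E1 -E2 opprB addrCA subrr addr0.
have mn : m = n by move: ffree ffull => /eqP rm /eqP rn; rewrite -[LHS]rm.
subst m; exists (\matrix_i e i); split; first by rewrite -row_free_unit.
apply/seteqP; split=> [x /comb[lam l0 ->]|_ [lam l0 <-]]; first by exists lam.
rewrite mulmx_sum_row; apply: cone_sum => i _; rewrite rowK.
by apply: CZ; [exact: l0|case: (fe.1 i)].
Qed.

End LatticeCone.

(** * The cone structure of the supports *)

Section OpenCone.
Variables (R : realType) (n : nat).
Implicit Types (x y z v w c d m : 'rV[R]_n).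

Lemma interior_line (A : set 'rV[R]_n) x v : interior A x ->
  exists2 e : R, 0 < e & forall s, `|s| <= e -> interior A (x + s *: v).
Proof.
move=> ix; have nA : nbhs x (interior A) by exact: nbhs_interior.
have [B B0 HB] : exists2 B : R, 0 < B & forall i, `|v ord0 i| <= B.
  exists (1 + \sum_i `|v ord0 i|); first by rewrite ltr_pwDl// sumr_ge0.
  move=> i; rewrite (bigD1 i)//= addrCA lerDl addr_ge0// sumr_ge0//.
have /nbhs_ballP[r /= r0 Hr] := nA.
exists (r / (2 * B)); first by rewrite divr_gt0// mulr_gt0.
move=> s hs; apply: Hr; apply/row_ballE; split=> // i.
rewrite !mxE opprD addrA subrr add0r normrN normrM.
apply: (@le_lt_trans _ _ (r / (2 * B) * B)); first exact: ler_pM.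
by rewrite invfM mulrA divfK ?gt_eqF//; lra.
Qed.

(** The form in which integrability excludes growth along a line or ray: superlevel sets are
    bounded. *)
Lemma admissible_direction f v d : admissible f -> 0 < f v ->
  (forall N : nat, exists s : R, N%:R <= `|s| /\ f v <= f (v + s *: d)) -> d = 0.
Proof.
move=> af fv H; apply/rowP => i; rewrite mxE; apply/eqP/negPn/negP => di.
have [y [D HD]] := superlevel_bounded af fv.
have /row_ballE[D0 /(_ i) B0] := HD v (lexx _).
have di0 : 0 < `|d ord0 i| by rewrite normr_gt0.
pose N := (Num.trunc (2 * D / `|d ord0 i|)).+1.
have NB : 2 * D < N%:R * `|d ord0 i| by rewrite -ltr_pdivrMr// truncnS_gt.
have [s [sN fs]] := H N.
have /row_ballE[_ /(_ i)] := HD _ fs; rewrite !mxE => B1.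
have : `|s * d ord0 i| < 2 * D.
  rewrite (_ : s * d ord0 i = (y ord0 i - v ord0 i) - (y ord0 i - (v ord0 i + s * d ord0 i)));
    last by ring.
  by apply: le_lt_trans (ler_normB _ _) _; rewrite mulr_natl mulr2n; exact: ltrD.
apply/negP; rewrite -leNgt normrM; apply: le_trans (ltW NB) _.
by rewrite ler_pM2r.
Qed.

Section Fixed.
Variables (f k : 'rV[R]_n -> R).
Hypotheses (af : admissible f) (ak : admissible k).
Let lf : log_concave f. Proof. by case: af. Qed.
Let lk : log_concave k. Proof. by case: ak. Qed.
Let cf : {within supp f, continuous f}. Proof. by case: af. Qed.
Let ck : {within supp k, continuous k}. Proof. by case: ak. Qed.
Notation KI := (interior (supp f)).
Notation LI := (interior (supp k)).

(** Midpoints of points near [x'] are still interior, so equality makes the product [f * k] positive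
    near [x']. *)
Lemma maximizer_interior x y x' : maximizer f k x y ->
  KI (2^-1 *: (x + x')) -> LI (2^-1 *: (y + x')) -> KI x' /\ LI x'.
Proof.
move=> [fx ky H] iK iL.
have cm (w : 'rV[R]_n) : continuous (fun u : 'rV[R]_n => 2^-1 *: (w + u)).
  rewrite (_ : (fun u => _) = fun u => 2^-1 *: u + 2^-1 *: w); first exact: continuous_affine.
  by apply/funext => u; rewrite scalerDr addrC.
have n1 : \forall u \near x', KI (2^-1 *: (x + u)) := cm x x' _ (nbhs_interior iK).
have n2 : \forall u \near x', LI (2^-1 *: (y + u)) := cm y x' _ (nbhs_interior iL).
have n3 : \forall u \near x', 0 < f u /\ 0 < k u.
  apply: filterS2 n1 n2 => u h1 h2.
  have : 0 < Num.sqrt (f x * k y) * Num.sqrt (f u * k u).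
    by rewrite -(H _ h1 h2) mulr_gt0//; [exact: interior_supp_gt0 h1|exact: interior_supp_gt0 h2].
  have s0 : 0 < Num.sqrt (f x * k y) by rewrite sqrtr_gt0 mulr_gt0.
  rewrite (pmulr_rgt0 _ s0) sqrtr_gt0 => fk.
  have f0 := log_concave_ge0 u lf; have k0 := log_concave_ge0 u lk.
  by split; rewrite lt_def ?f0 ?k0 andbT; apply: contraTneq fk => ->;
    rewrite ?mul0r ?mulr0 ltxx.
by split; [change (nbhs x' (supp f))|change (nbhs x' (supp k))];
  apply: filterS n3 => u [fu ku]; exact: pos_supp.
Qed.

(** The midpoint inequalities for [f] and [k] multiply to an equality of positive numbers, so each
    is an equality. *)
Lemma maximizer_ln x y x' : maximizer f k x y ->
  KI (2^-1 *: (x + x')) -> LI (2^-1 *: (y + x')) ->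
  ln (f (2^-1 *: (x + x'))) = 2^-1 * (ln (f x) + ln (f x')).
Proof.
move=> mxy iK iL; have [iK' iL'] := maximizer_interior mxy iK iL.
have [fx ky H] := mxy.
have fx' := interior_supp_gt0 lf cf iK'; have kx' := interior_supp_gt0 lk ck iL'.
have fm := interior_supp_gt0 lf cf iK; have km := interior_supp_gt0 lk ck iL.
have h1 := log_concave_mid x x' lf; have h2 := log_concave_mid y x' lk.
have E : (f x * f x') * (k y * k x') = f (2^-1 *: (x + x')) ^+ 2 * k (2^-1 *: (y + x')) ^+ 2.
  by rewrite -exprMn (H _ iK iL) exprMn !sqr_sqrtr ?mulr_ge0 ?ltW//; ring.
have E1 : f x * f x' = f (2^-1 *: (x + x')) ^+ 2.
  apply/eqP; rewrite eq_le h1/= leNgt; apply/negP => lt1.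
  have : (f x * f x') * (k y * k x') < f (2^-1 *: (x + x')) ^+ 2 * k (2^-1 *: (y + x')) ^+ 2.
    apply: (@lt_le_trans _ _ (f (2^-1 *: (x + x')) ^+ 2 * (k y * k x'))).
      by rewrite ltr_pM2r// mulr_gt0.
    by rewrite ler_pM2l// exprn_gt0.
  by rewrite E ltxx.
have := congr1 (@ln R) E1; rewrite lnM ?posrE// lnXn// => ->.
by move: (ln _) => L; rewrite -[L *+ 2]mulr_natl mulKf// pnatr_eq0.
Qed.

Definition good z := exists u, KI u /\ LI (u - z).

Hypothesis Hmax : forall z, good z -> exists x y, x - y = 2 *: z /\ maximizer f k x y.

(** For a maximizer at [a - b], the point [2 *: a - x] has midpoint [a] with [x] and midpoint [b]
    with [y]. *)
Lemma interior_meet : exists d, KI d /\ LI d.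
Proof.
have [_ _ [a ia] _] := af; have [_ _ [b ib] _] := ak.
have gz : good (a - b) by exists a; split=> //; rewrite opprB addrC subrK.
have [x [y [xy mxy]]] := Hmax gz.
exists (2 *: a - x); apply: (maximizer_interior mxy).
  by rewrite addrC subrK scalerA mulVf ?scale1r// pnatr_eq0.
rewrite (_ : 2^-1 *: _ = b)//.
rewrite (_ : y = x - 2 *: (a - b)); last by rewrite -xy subKr.
rewrite (_ : x - 2 *: (a - b) + (2 *: a - x) = 2 *: b); last by vring.
by rewrite scalerA mulVf ?scale1r// pnatr_eq0.
Qed.

(** A maximizer at [z] may consist of boundary points. One at [(1 + e) *: z], contracted by
    [1 - t = 1 / (1 + e)] towards a common interior point [d], gives interior points that differ by
    [2 *: z]. *)
Lemma good_double z : good z -> good (2 *: z).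
Proof.
move=> [u [iu iuz]]; have [d [Kd Ld]] := interior_meet.
have [e e0 He] := interior_line (- z) iuz.
have gz : good ((1 + e) *: z).
  exists u; split; first exact: iu.
  rewrite (_ : u - _ = u - z + e *: (- z)); last by vring.
  by apply: He; rewrite ger0_norm// ltW.
have [x [y [xy [fx ky _]]]] := Hmax gz.
pose t := e / (1 + e).
have t01 : 0 < t <= 1.
  by rewrite /t divr_gt0 ?addr_gt0//= ler_pdivrMr ?addr_gt0//; lra.
exists ((1 - t) *: x + t *: d); split.
  by apply: supp_interior_conv => //; exact: pos_supp.
rewrite (_ : _ - _ = (1 - t) *: y + t *: d).
  by apply: supp_interior_conv => //; exact: pos_supp.
rewrite (_ : y = x - 2 *: ((1 + e) *: z)); last by rewrite -xy subKr.
have et : (1 - t) * (1 + e) = 1 by rewrite /t; field; rewrite gt_eqF// addr_gt0.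
rewrite scalerBr !scalerA [2 * _]mulrC mulrA et mul1r.
by rewrite addrAC.
Qed.

Lemma all_good z : good z.
Proof.
have [d [Kd Ld]] := interior_meet.
have [e e0 He] := interior_line (- z) Ld.
pose N := (Num.trunc e^-1).+1.
have Ne : N%:R^-1 <= e.
  by rewrite -[e]invrK lef_pV2 ?posrE ?invr_gt0 ?ltr0n// ltW// truncnS_gt.
have pN : (N <= 2 ^ N)%N by apply: ltnW; exact: ltn_expl.
have H j : good ((2 ^+ j / 2 ^+ N) *: z).
  elim: j => [|j IH].
    exists d; split=> //; rewrite -scalerN; apply: He.
    rewrite expr0 mul1r ger0_norm ?invr_ge0 ?exprn_ge0//; apply: le_trans Ne.
    by rewrite lef_pV2 ?posrE ?ltr0n ?exprn_gt0// -natrX ler_nat.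
  by have := good_double IH; rewrite scalerA mulrA -exprS.
by have := H N; rewrite mulfV ?scale1r// expf_neq0// pnatr_eq0.
Qed.

End Fixed.
End OpenCone.

(** * The open cone, its translates, and [ln f] along rays *)

Section RayAffine.
Variables (R : realType) (n : nat).
Implicit Types (x y z v w c d m : 'rV[R]_n).
Variables (f k : 'rV[R]_n -> R).
Hypotheses (af : admissible f) (ak : admissible k).
Variables (mx my : 'rV[R]_n -> 'rV[R]_n).
Hypothesis mxP : forall z, mx z - my z = 2 *: z /\ maximizer f k (mx z) (my z).
Variable q : 'rV[R]_n.
Hypothesis qP : maximizer f k q q.
Let lf : log_concave f. Proof. by case: af. Qed.
Let lk : log_concave k. Proof. by case: ak. Qed.
Let cf : {within supp f, continuous f}. Proof. by case: af. Qed.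
Let ck : {within supp k, continuous k}. Proof. by case: ak. Qed.
Notation KI := (interior (supp f)).
Notation LI := (interior (supp k)).

Definition ocone c := KI (q + c) /\ LI (q + c).
(** Recession cone of [ocone], standing for its closure; additivity is immediate in this form. *)
Definition ccone d := forall c, ocone c -> ocone (d + c).
(** By [apexP] and [apex_ocone], the interior of [supp f] meets the [z]-translate of the interior of
    [supp k] exactly in [apex z + ocone]. *)
Definition apex z := 2^-1 *: (mx z + q).

Let fq : 0 < f q. Proof. by case: qP. Qed.
Let kq : 0 < k q. Proof. by case: qP. Qed.

Lemma ocone_exists : exists e, ocone e.
Proof.
have H z : good f k z -> exists x y, x - y = 2 *: z /\ maximizer f k x y.
  by move=> _; exists (mx z), (my z); exact: mxP.
by have [d [Kd Ld]] := interior_meet af ak H; exists (d - q); rewrite /ocone addrC subrK.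
Qed.

(** Factors at most 1 come from convexity towards [q], the factor 2 from equality at the pair
    [(q, q)]. *)
Lemma oconeZ (t : R) c : 0 < t -> ocone c -> ocone (t *: c).
Proof.
have sml s c' : 0 < s <= 1 -> ocone c' -> ocone (s *: c').
  move=> s01 [Kc Lc]; rewrite /ocone.
  rewrite (_ : q + s *: c' = (1 - s) *: q + s *: (q + c')); last by vring.
  by split; apply: supp_interior_conv => //; exact: pos_supp.
have dbl c' : ocone c' -> ocone (2 *: c').
  have E : 2^-1 *: (q + (q + 2 *: c')) = q + c'.
    by apply/rowP => i; rewrite !mxE; field.
  by move=> [Kc Lc]; apply: (maximizer_interior af ak qP); rewrite E.
move=> t0 oc; pose N := (Num.trunc t).+1.
have tN : t < N%:R by exact: truncnS_gt.
have pN : N%:R <= 2 ^+ N :> R by rewrite -natrX ler_nat ltnW// ltn_expl.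
have oN j : ocone (2 ^+ j *: c).
  by elim: j => [|j IH]; [rewrite expr0 scale1r|rewrite exprS -scalerA; exact: dbl].
rewrite (_ : t *: c = (t / 2 ^+ N) *: (2 ^+ N *: c)).
  apply: (sml _ _ _ (oN _)); rewrite divr_gt0 ?exprn_gt0//= ler_pdivrMr ?exprn_gt0// mul1r.
  by apply: le_trans pN; exact: ltW.
by rewrite scalerA divfK// expf_neq0// pnatr_eq0.
Qed.

Lemma oconeD c c' : ocone c -> ocone c' -> ocone (c + c').
Proof.
move=> [Kc Lc] [Kc' Lc'].
have : ocone (2^-1 *: (c + c')).
  rewrite /ocone (_ : q + _ = (1 - 2^-1) *: (q + c) + 2^-1 *: (q + c')).
    have h01 : 0 < (2^-1 : R) <= 1 by apply/andP; split; lra.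
    split; first exact: (supp_interior_conv lf (interior_subset Kc) Kc' h01).
    exact: (supp_interior_conv lk (interior_subset Lc) Lc' h01).
  by apply/rowP => i; rewrite !mxE; field.
move=> /(oconeZ (ltr0n R 2)); rewrite scalerA mulfV ?scale1r// pnatr_eq0//.
Qed.

Lemma ocone_line c v : ocone c -> exists2 e : R, 0 < e &
  forall s, `|s| <= e -> ocone (c + s *: v).
Proof.
move=> [Kc Lc]; have [e1 e10 H1] := interior_line v Kc; have [e2 e20 H2] := interior_line v Lc.
exists (Num.min e1 e2); first by rewrite lt_min e10.
by move=> s; rewrite le_min => /andP[s1 s2]; rewrite /ocone addrA; split; [exact: H1|exact: H2].
Qed.

Lemma ocone_ccone c : ocone c -> ccone c.
Proof. by move=> oc c' oc'; exact: oconeD. Qed.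

Lemma ccone0 : ccone 0.
Proof. by move=> c; rewrite add0r. Qed.

Lemma cconeD d d' : ccone d -> ccone d' -> ccone (d + d').
Proof. by move=> h h' c oc; rewrite -addrA; apply: h; exact: h'. Qed.

Lemma cconeZ (t : R) d : 0 <= t -> ccone d -> ccone (t *: d).
Proof.
rewrite le_eqVlt => /orP[/eqP<- _|t0 hd c oc]; first by rewrite scale0r; exact: ccone0.
rewrite (_ : _ + c = t *: (d + t^-1 *: c)).
  have ti : 0 < t^-1 by rewrite invr_gt0.
  exact: (oconeZ t0 (hd _ (oconeZ ti oc))).
by rewrite scalerDr scalerA mulfV ?scale1r// gt_eqF.
Qed.

Lemma ccone_arch d v : (forall e : R, 0 < e -> ccone (d + e *: v)) -> ccone d.
Proof.
move=> H c oc; have [e e0 He] := ocone_line (- v) oc.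
have ob : ocone (c + e *: - v) by apply: He; rewrite ger0_norm// ltW.
have := H e e0 _ ob.
by rewrite scalerN addrACA subrr addr0.
Qed.

(** [x + c] is a convex combination of [x] and a point of [q + ocone]; openness of the cone absorbs
    the correction [t *: (x - q)]. *)
Lemma supp_ocone x c : supp f x -> ocone c -> KI (x + c).
Proof.
move=> Kx oc; have [e e0 He] := ocone_line (x - q) oc.
pose t := Num.min e 1.
have t0 : 0 < t by rewrite lt_min e0 ltr01.
have t1 : t <= 1 by rewrite ge_min lexx orbT.
have [Kt _] : ocone (t^-1 *: (c + t *: (x - q))).
  apply: oconeZ; first by rewrite invr_gt0.
  by apply: He; rewrite (ger0_norm (ltW t0)) ge_min lexx.
rewrite (_ : x + c = (1 - t) *: x + t *: (q + t^-1 *: (c + t *: (x - q)))).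
  by apply: supp_interior_conv; rewrite ?t0.
rewrite scalerDr scalerA mulfV ?gt_eqF// scale1r; vring.
Qed.

Lemma supp_ocone' x c : supp k x -> ocone c -> LI (x + c).
Proof.
move=> Kx oc; have [e e0 He] := ocone_line (x - q) oc.
pose t := Num.min e 1.
have t0 : 0 < t by rewrite lt_min e0 ltr01.
have t1 : t <= 1 by rewrite ge_min lexx orbT.
have [_ Kt] : ocone (t^-1 *: (c + t *: (x - q))).
  apply: oconeZ; first by rewrite invr_gt0.
  by apply: He; rewrite (ger0_norm (ltW t0)) ge_min lexx.
rewrite (_ : x + c = (1 - t) *: x + t *: (q + t^-1 *: (c + t *: (x - q)))).
  by apply: supp_interior_conv; rewrite ?t0.
rewrite scalerDr scalerA mulfV ?gt_eqF// scale1r; vring.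
Qed.

Lemma my_eq z : my z = mx z - 2 *: z.
Proof. by have [<- _] := mxP z; rewrite subKr. Qed.

(** The reflected point [2 *: m - mx z] has midpoint [m] with [mx z] and [m - z] with [my z], so
    equality puts it in both interiors. Half of its offset from [q] is [m - apex z]. *)
Lemma apexP z m : KI m -> LI (m - z) -> ocone (m - apex z).
Proof.
move=> Km Lm; have [_ mz] := mxP z.
have [K' L'] : KI (2 *: m - mx z) /\ LI (2 *: m - mx z).
  apply: (maximizer_interior af ak mz).
    rewrite (_ : 2^-1 *: (mx z + (2 *: m - mx z)) = m)//.
    by apply/rowP => i; rewrite !mxE; field.
  rewrite my_eq (_ : 2^-1 *: (mx z - 2 *: z + (2 *: m - mx z)) = m - z)//.
  by apply/rowP => i; rewrite !mxE; field.
rewrite (_ : m - apex z = 2^-1 *: (2 *: m - mx z - q)).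
  by apply: oconeZ; [rewrite invr_gt0|rewrite /ocone addrC subrK].
by apply/rowP => i; rewrite !mxE; field.
Qed.

Lemma apex_ocone z c : ocone c -> KI (apex z + c) /\ LI (apex z + c - z).
Proof.
move=> oc; have [_ [fx ky _]] := mxP z.
have oc2 : ocone (2 *: c) by exact: oconeZ.
have [K2 L2] := oc2.
rewrite (_ : apex z + c = (1 - 2^-1) *: mx z + 2^-1 *: (q + 2 *: c)); last first.
  by apply/rowP => i; rewrite !mxE; field.
rewrite (_ : _ - z = (1 - 2^-1) *: my z + 2^-1 *: (q + 2 *: c)); last first.
  by rewrite my_eq; apply/rowP => i; rewrite !mxE; field.
by split; (apply: supp_interior_conv => //; [exact: pos_supp|apply/andP; split; lra]).
Qed.

Definition slope c := ln (f (q + c)) - ln (f q).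

Lemma ln_apex z c : ocone c ->
  ln (f (apex z + c)) = 2^-1 * (ln (f (mx z)) + ln (f q)) + 2^-1 * slope (2 *: c).
Proof.
move=> oc; have [_ mz] := mxP z; have [K1 L1] := apex_ocone z oc.
have E1 : apex z + c = 2^-1 *: (mx z + (q + 2 *: c)).
  by apply/rowP => i; rewrite !mxE; field.
have E2 : apex z + c - z = 2^-1 *: (my z + (q + 2 *: c)).
  by rewrite my_eq; apply/rowP => i; rewrite !mxE; field.
rewrite E2 in L1; rewrite E1 in K1 *; rewrite (maximizer_ln af ak mz K1 L1) /slope; ring.
Qed.

Lemma slope_half c : ocone c -> slope (2 *: c) = 2 * slope c.
Proof.
move=> oc; have [K1 L1] := oc.
have E1 : q + c = 2^-1 *: (q + (q + 2 *: c)) by apply/rowP => i; rewrite !mxE; field.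
by rewrite E1 in K1 L1; have := maximizer_ln af ak qP K1 L1; rewrite -E1 /slope => ->; field.
Qed.

(** Concavity gives one inequality for factors [s <= 1]. For the other, [2 ^- N *: c] with
    [2 ^- N <= s] lies between the vertex and [s *: c], and its slope is known exactly from
    [slope_half]. *)
Lemma slopeZ (t : R) c : 0 < t -> ocone c -> slope (t *: c) = t * slope c.
Proof.
have conc s c' : 0 < s <= 1 -> ocone c' -> s * slope c' <= slope (s *: c').
  move=> /andP[s0 s1] [Kc _].
  have fc := interior_supp_gt0 lf cf Kc.
  have s01 : 0 <= s <= 1 by rewrite ltW.
  have [_] := log_concave_ln lf fq fc s01.
  rewrite (_ : (1 - s) *: q + s *: (q + c') = q + s *: c'); last by vring.
  rewrite /slope; lra.
have pw j c' : ocone c' -> slope (2 ^- j *: c') = 2 ^- j * slope c'.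
  move=> oc; elim: j => [|j IH]; first by rewrite expr0 invr1 scale1r mul1r.
  have oj : ocone (2 ^- j.+1 *: c') by apply: oconeZ => //; rewrite invr_gt0 exprn_gt0.
  have := slope_half oj; rewrite scalerA exprS invfM mulrA mulfV ?pnatr_eq0// mul1r IH => E.
  by rewrite -mulrA E mulKf// pnatr_eq0.
have le1 s c' : 0 < s <= 1 -> ocone c' -> slope (s *: c') = s * slope c'.
  move=> s01 oc; have /andP[s0 s1] := s01.
  apply/le_anti; rewrite conc// andbT.
  pose N := (Num.trunc s^-1).+1.
  have sN : s^-1 < N%:R by exact: truncnS_gt.
  have pN : N%:R <= 2 ^+ N :> R by rewrite -natrX ler_nat ltnW// ltn_expl.
  have p0 : 0 < 2 ^- N :> R by rewrite invr_gt0 exprn_gt0.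
  have ps : 2 ^- N <= s.
    by rewrite -[s]invrK lef_pV2 ?posrE ?exprn_gt0 ?invr_gt0// (le_trans (ltW sN)).
  have os : ocone (s *: c') by exact: oconeZ.
  have r01 : 0 < 2 ^- N / s <= 1 by rewrite divr_gt0//= ler_pdivrMr// mul1r.
  have := conc _ _ r01 os; rewrite scalerA divfK ?gt_eqF// pw//.
  by rewrite -mulrA ler_pM2l// mulrC ler_pdivrMr// mulrC.
move=> t0 oc; have [t1|t1] := leP t 1; first by apply: le1; rewrite ?t0.
have ot : ocone (t *: c) by exact: oconeZ.
have ti : 0 < t^-1 <= 1 by rewrite invr_gt0 t0/= invf_le1// ltW.
have := le1 _ _ ti ot; rewrite scalerA mulVf ?gt_eqF// scale1r => ->.
by rewrite mulrA mulfV ?mul1r// gt_eqF.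
Qed.

Definition apex_level z := 2^-1 * (ln (f (mx z)) + ln (f q)).

Lemma ln_apex_slope z c : ocone c -> ln (f (apex z + c)) = apex_level z + slope c.
Proof. by move=> oc; rewrite ln_apex// slope_half// mulKf// pnatr_eq0. Qed.

(* If the apex at z lies below q in the cone order, doubling z repeatedly makes
   [ln f] affine along the whole line through q and the apex, against decay. *)
Lemma apex_eq z : ccone (q - apex z) -> apex z = q.
Proof.
move=> hd; apply/eqP; rewrite eq_sym -subr_eq0; apply/eqP; set d := q - apex z in hd *.
have [c oc] := ocone_exists.
have fpos c' : ocone c' -> 0 < f (q + c') by move=> [Kc' _]; exact: (interior_supp_gt0 lf cf).
have fc := fpos c oc.
pose beta := ln (f q) - apex_level z.
have slopeD c' : ocone c' -> slope (d + c') = slope c' + beta.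
  move=> oc'; have := ln_apex_slope z (hd _ oc').
  rewrite (_ : apex z + (d + c') = q + c'); last by rewrite /d; vring.
  have : slope c' = ln (f (q + c')) - ln (f q) by [].
  by rewrite /beta => -> ->; ring.
have slopeMn N c' : ocone c' -> ocone (N%:R *: d + c') /\
    slope (N%:R *: d + c') = slope c' + N%:R * beta.
  move=> oc'; elim: N => [|N [oN sN]]; first by rewrite scale0r add0r mul0r addr0.
  rewrite (_ : N.+1%:R *: d + c' = d + (N%:R *: d + c')); last by rewrite -natr1; vring.
  by split; [exact: hd|rewrite slopeD// sN -natr1; ring].
(* The apex at [2 ^+ j *: z] lies below [q - 2 ^+ j *: d]. The induction uses that
   [2 *: apex zj - q] is [mx zj], and that the apex at [2 *: zj] lies below [mx zj] because
   [mx zj - 2 *: zj = my zj] is in the support of [k]. *)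
have wP j : ccone (q - 2 ^+ j *: d - apex (2 ^+ j *: z)).
  elim: j => [|j IH].
    rewrite !scale1r (_ : _ - _ = 0); first exact: ccone0.
    by rewrite /d; vring.
  set zj := 2 ^+ j *: z in IH *.
  have step : ccone (2 *: apex zj - q - apex (2 *: zj)).
    move=> c' oc'; have [_ [fx ky _]] := mxP zj.
    rewrite (_ : _ + c' = mx zj + c' - apex (2 *: zj)).
      apply: apexP; first by apply: supp_ocone => //; exact: pos_supp.
      rewrite addrAC -my_eq; apply: supp_ocone' => //; exact: pos_supp.
    by apply/rowP => i; rewrite !mxE; field.
  rewrite exprS -!scalerA -/zj.
  rewrite (_ : _ - _ = (2 *: apex zj - q - apex (2 *: zj)) + 2 *: (q - 2 ^+ j *: d - apex zj)).
    exact: (cconeD step (cconeZ (ler0n R 2) IH)).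
  by rewrite scalerA; vring.
apply: (admissible_direction af fc) => N.
(* [beta] is the increment of [ln f] along [d]. If it is negative, the line is followed backwards:
   [q + c - M *: d] may leave [q + ocone], but it lies in [apex zN + ocone], where [ln f] has the
   same increments. *)
have [b0|b0] := leP 0 beta.
  exists N%:R; split; first by rewrite ger0_norm.
  have [oN sN] := slopeMn N c oc.
  rewrite (_ : q + c + _ = q + (N%:R *: d + c)); last by vring.
  have fN := fpos _ oN.
  rewrite -ler_ln ?posrE//; move: sN; rewrite /slope => sN.
  have : 0 <= N%:R * beta by exact: mulr_ge0.
  by lra.
pose M := 2 ^+ N : R.
exists (- M); split.
  rewrite normrN ger0_norm ?exprn_ge0// /M -natrX ler_nat; apply: ltnW; exact: ltn_expl.
set zN := 2 ^+ N *: z; have wN := wP N; rewrite -/zN in wN.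
set w := q - 2 ^+ N *: d - apex zN in wN.
have ow := wN _ oc.
have [oM sM] := slopeMn (2 ^ N)%N _ ow; rewrite natrX -/M in oM sM.
have L1 := ln_apex_slope zN ow; have L2 := ln_apex_slope zN oM.
have E1 : apex zN + (w + c) = q + c + (- M) *: d by rewrite /w /M; vring.
have E2 : apex zN + (M *: d + (w + c)) = q + c by rewrite /w /M; vring.
rewrite E1 in L1; rewrite E2 in L2.
have [K1 _] := apex_ocone zN ow; rewrite E1 in K1.
have f1 := interior_supp_gt0 lf cf K1.
rewrite -ler_ln ?posrE// L1 L2 sM.
have : M * beta <= 0 by rewrite mulr_ge0_le0 ?exprn_ge0// ltW.
by lra.
Qed.

End RayAffine.

(** * Lattice order on the cone and additivity of [ln f] *)

Section Structure.
Variables (R : realType) (n : nat).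
Implicit Types (x y z v w c d m : 'rV[R]_n).

Lemma maximizer_sym (f k : 'rV[R]_n -> R) x y : maximizer f k x y -> maximizer k f y x.
Proof.
move=> [fx ky H]; split=> // x' iL iK.
by rewrite mulrC (H _ iK iL); congr (Num.sqrt _ * Num.sqrt _); rewrite mulrC.
Qed.

(** Exchanging [f] and [k] reverses [z], so each one-sided result also yields its mirror image. *)
Lemma choice_sym (f k : 'rV[R]_n -> R) (mx my : 'rV[R]_n -> 'rV[R]_n) :
  (forall z, mx z - my z = 2 *: z /\ maximizer f k (mx z) (my z)) ->
  forall z, my (- z) - mx (- z) = 2 *: z /\ maximizer k f (my (- z)) (mx (- z)).
Proof.
move=> H z; have [E mz] := H (- z); split; last exact: maximizer_sym.
by rewrite -opprB E scalerN opprK.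
Qed.

Lemma ocone_sym (f k : 'rV[R]_n -> R) q c : ocone f k q c -> ocone k f q c.
Proof. by case. Qed.

Lemma ccone_sym (f k : 'rV[R]_n -> R) q c : ccone f k q c -> ccone k f q c.
Proof. by move=> H c' /ocone_sym /H /ocone_sym. Qed.

Section OneSided.
Variables (f k : 'rV[R]_n -> R).
Hypotheses (af : admissible f) (ak : admissible k).
Variables (mx my : 'rV[R]_n -> 'rV[R]_n).
Hypothesis mxP : forall z, mx z - my z = 2 *: z /\ maximizer f k (mx z) (my z).
Variable q : 'rV[R]_n.
Hypothesis qP : maximizer f k q q.
Let lf : log_concave f. Proof. by case: af. Qed.
Let lk : log_concave k. Proof. by case: ak. Qed.
Let cf : {within supp f, continuous f}. Proof. by case: af. Qed.
Let ck : {within supp k, continuous k}. Proof. by case: ak. Qed.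
Notation KI := (interior (supp f)).
Notation LI := (interior (supp k)).
Notation oc := (ocone f k q).
Notation cc := (ccone f k q).
Notation ap := (apex mx q).

Lemma apex_sub_eq z : cc (q - (ap z - z)) -> ap z - z = q.
Proof.
have E : apex (fun z => my (- z)) q (- z) = ap z - z.
  by rewrite /apex opprK (my_eq mxP); apply/rowP => i; rewrite !mxE; field.
move=> /ccone_sym; rewrite -E.
exact: (apex_eq ak af (choice_sym mxP) (maximizer_sym qP)).
Qed.

(** [apex_eq] and its mirror image [apex_sub_eq] both apply at [d], giving [q = ap d = q + d]. *)
Lemma ccone_pt d : cc d -> cc (- d) -> d = 0.
Proof.
move=> hd hNd.
have E1 : ap d = q.
  apply: (apex_eq af ak mxP qP) => c oc; rewrite addrAC.
  apply: (apexP af ak mxP qP); first by case: oc.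
  by rewrite -addrA [c - d]addrC; case: (hNd _ oc).
have E2 : ap d - d = q.
  apply: apex_sub_eq => c oc.
  rewrite (_ : _ + c = q + (d + c) - ap d); last by vring.
  apply: (apexP af ak mxP qP); first by case: (hd _ oc).
  by rewrite (_ : _ - d = q + c); [case: oc|vring].
by apply/eqP; rewrite -oppr_eq0 -(subrr q) -{1}E2 E1 addrAC subrr add0r.
Qed.

(** [z] is taken so far back in the cone that [q + v - z] is interior to [supp k]. The apex at [z]
    still lies below [q], hence equals [q] by [apex_eq], and [apexP] at [q + v] concludes. *)
Lemma interior_ocone v : KI (q + v) -> oc v.
Proof.
move=> Kv; have [e oe] := ocone_exists af ak mxP q.
have [t0 t00 Ht] := ocone_line v oe.
have ove : oc (v + t0^-1 *: e).
  rewrite (_ : _ + _ = t0^-1 *: (e + t0 *: v)).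
    apply: (oconeZ af ak qP); first by rewrite invr_gt0.
    by apply: Ht; rewrite ger0_norm// ltW.
  by rewrite scalerDr scalerA mulVf ?gt_eqF// scale1r addrC.
pose z := - (t0^-1 *: e).
have hz : cc (q - ap z).
  move=> c oc; rewrite addrAC; apply: (apexP af ak mxP qP); first by case: oc.
  rewrite /z opprK -addrA.
  have ti : 0 < t0^-1 by rewrite invr_gt0.
  by have [_ H] := oconeD af ak qP oc (oconeZ af ak qP ti oe); exact: H.
have E := apex_eq af ak mxP qP hz.
have Lv : LI (q + v - z) by rewrite /z opprK -addrA; case: ove.
have := apexP af ak mxP qP Kv Lv; rewrite E.
by rewrite (_ : q + v - q = v); last by vring.
Qed.

Hypothesis ocK : forall v, LI (q + v) -> oc v.

(** The join of 0 and [z] is the apex measured from [q]: both interiors now lie in [q + ocone], and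
    [apex z + ocone] is the intersection. *)
Lemma ccone_join z : exists p, forall x, (cc x /\ cc (x - z)) <-> cc (x - p).
Proof.
exists (ap z - q) => x; split=> [[h1 h2] c oc|h].
  rewrite (_ : _ + c = q + (x + c) - ap z); last by vring.
  apply: (apexP af ak mxP qP); first by case: (h1 _ oc).
  by rewrite (_ : _ - z = q + (x - z + c)); [case: (h2 _ oc)|vring].
have H c : oc c -> KI (q + (x + c)) /\ LI (q + (x - z + c)).
  move=> oc; have [K1 L1] := apex_ocone af ak mxP qP z (h c oc).
  have E1 : q + (x + c) = ap z + (x - (ap z - q) + c) by vring.
  have E2 : q + (x - z + c) = ap z + (x - (ap z - q) + c) - z by vring.
  rewrite E1 E2; split; [exact: K1|exact: L1].
split=> c oc; have [K1 L1] := H c oc; [exact: interior_ocone K1|exact: ocK L1].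
Qed.

Lemma ccone_simplicial : simplicial_cone cc.
Proof.
apply: lattice_cone_simplicial.
- exact: ccone0.
- exact: cconeD.
- exact: (cconeZ af ak qP).
- exact: ccone_pt.
- by move=> x y; exact: ccone_arch.
- exact: ccone_join.
Qed.

Lemma supp_ccone : supp f = [set q + x | x in cc].
Proof.
have [e oe] := ocone_exists af ak mxP q.
apply/seteqP; split=> [x Kx|_ [d hd <-]].
  exists (x - q); last by rewrite addrC subrK.
  move=> c oc; apply: interior_ocone; rewrite (_ : q + _ = x + c); last by vring.
  exact: (supp_ocone af ak qP Kx oc).
(* [q + d] is approached by [q + d + s *: e] with [s > 0], where [f] is positive. *)
move=> B nB.
have c1 : continuous (fun s : R => (q + d) + s *: e).
  move=> s; have h1 : u *: e @[u --> s] --> s *: e by exact: scalel_continuous.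
  exact: (cvgD (cvg_cst (q + d)) h1).
have nB' : nbhs (0 : R) [set s | B ((q + d) + s *: e)].
  by apply: (c1 0); rewrite scale0r addr0.
have [s [Bs s0]] : exists s, B ((q + d) + s *: e) /\ 0 < s.
  have /nbhs_ballP[r /= r0 Hr] := nB'.
  exists (r / 2); split; last by rewrite divr_gt0.
  by apply: Hr; rewrite /ball /= sub0r normrN ger0_norm; lra.
exists ((q + d) + s *: e); split=> //=.
have [K1 _] : oc (d + s *: e) by apply: hd; exact: (oconeZ af ak qP).
by rewrite -addrA gt_eqF//; exact: (interior_supp_gt0 lf).
Qed.

Notation sl := (slope f q).

Lemma slope_add c c' : oc c -> oc c' -> sl (c + c') = sl c + sl c'.
Proof.
(* For [c0] in the open cone the apex at [c0] is [q + c0], so on this translate [ln f] is [sl] up to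
   a constant. *)
have shift c0 : oc c0 -> exists r, forall c1, oc c1 -> sl (c0 + c1) = r + sl c1.
  move=> oc0; exists (apex_level f mx q c0 - ln (f q)) => c1 oc1.
  have E : ap c0 = q + c0.
    apply/eqP; rewrite -subr_eq0; apply/eqP; apply: ccone_pt => c2 oc2.
      rewrite (_ : ap c0 - (q + c0) + c2 = ap c0 + c2 - c0 - q); last by vring.
      by have [_ L1] := apex_ocone af ak mxP qP c0 oc2; apply: ocK; rewrite addrC subrK.
    rewrite (_ : _ + c2 = q + (c0 + c2) - ap c0); last by vring.
    apply: (apexP af ak mxP qP); first by case: (oconeD af ak qP oc0 oc2).
    by rewrite (_ : _ - c0 = q + c2); [case: oc2|vring].
  have := ln_apex_slope af ak mxP qP c0 oc1.
  rewrite E -addrA => h.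
  have -> : sl (c0 + c1) = ln (f (q + (c0 + c1))) - ln (f q) by [].
  by rewrite h; ring.
move=> oc1 oc2.
have [r1 H1] := shift c oc1; have [r2 H2] := shift c' oc2.
have two : 0 < (2 : R) by [].
have Z := slopeZ af ak qP two.
(* [sl (c + c') - sl c - sl c'] is a constant, and homogeneity kills it. *)
have od1 := oconeZ af ak qP two oc1; have od2 := oconeZ af ak qP two oc2.
have A1 := H1 _ oc2; have A2 := H1 _ od2; have A3 := H2 _ oc1; have A4 := H2 _ od1.
have [r3 H3] := shift _ od1; have [r4 H4] := shift _ od2.
have B1 := H3 _ oc2; have B2 := H3 _ od2; have B3 := H4 _ od1; have B4 := H4 _ oc1.
have E2 : sl (2 *: c + 2 *: c') = 2 * sl (c + c').
  by rewrite -scalerDr (Z _ (oconeD af ak qP oc1 oc2)).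
rewrite [c' + c]addrC in A3; rewrite [c' + 2 *: c]addrC in A4.
rewrite [2 *: c' + c]addrC in B4; rewrite [2 *: c' + 2 *: c]addrC in B3.
rewrite E2 in B2 B3; rewrite (Z _ oc1) in A4 B3; rewrite (Z _ oc2) in A2 B2.
move: A1 A2 A3 A4 B1 B2 B3 B4.
move: (sl (c + c')) (sl c) (sl c') (sl (c + 2 *: c')) (sl (2 *: c + c')).
move=> s0 s1 s2 s3 s4; lra.
Qed.

End OneSided.
End Structure.

(** * Linear exponents on the whole support *)

Section ExponentialForm.
Variables (R : realType) (n : nat).
Implicit Types (x y z v w c d m : 'rV[R]_n).

Lemma dotvDr (a x y : 'rV[R]_n) : dotv a (x + y) = dotv a x + dotv a y.
Proof. by rewrite /dotv -big_split; apply: eq_bigr => i _; rewrite mxE mulrDr. Qed.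

Lemma dotvZr (a : 'rV[R]_n) (t : R) x : dotv a (t *: x) = t * dotv a x.
Proof. by rewrite /dotv mulr_sumr; apply: eq_bigr => i _; rewrite mxE mulrCA. Qed.

Lemma dotvNr (a x : 'rV[R]_n) : dotv a (- x) = - dotv a x.
Proof. by rewrite -scaleN1r dotvZr mulN1r. Qed.

Lemma dotvNl (a x : 'rV[R]_n) : dotv (- a) x = - dotv a x.
Proof. by rewrite /dotv -sumrN; apply: eq_bigr => i _; rewrite mxE mulNr. Qed.

Lemma dotv_mulmx (W : 'M[R]_n) (s : 'I_n -> R) : W \in unitmx ->
  exists a : 'rV[R]_n, forall lam : 'rV[R]_n, dotv a (lam *m W) = \sum_i lam ord0 i * s i.
Proof.
move=> uW; exists ((invmx W *m (\col_i s i))^T) => lam.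
transitivity ((lam *m W *m (invmx W *m (\col_i s i))) ord0 ord0).
  by rewrite [RHS]mxE /dotv; apply: eq_bigr => i _; rewrite [X in X * _]mxE mulrC.
rewrite mulmxA mulmxK// mxE; apply: eq_bigr => i _; by rewrite [X in _ * X]mxE.
Qed.

Variables (f k : 'rV[R]_n -> R).
Hypotheses (af : admissible f) (ak : admissible k).
Variables (mx my : 'rV[R]_n -> 'rV[R]_n).
Hypothesis mxP : forall z, mx z - my z = 2 *: z /\ maximizer f k (mx z) (my z).
Variable q : 'rV[R]_n.
Hypothesis qP : maximizer f k q q.
Let lf : log_concave f. Proof. by case: af. Qed.
Let cf : {within supp f, continuous f}. Proof. by case: af. Qed.
Notation KI := (interior (supp f)).
Notation LI := (interior (supp k)).
Notation oc := (ocone f k q).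
Notation cc := (ccone f k q).
Notation sl := (slope f q).
Hypothesis ocK : forall v, LI (q + v) -> oc v.

Lemma slope_linear : exists a : 'rV[R]_n, forall c, oc c -> sl c = dotv a c.
Proof.
have [e oe] := ocone_exists af ak mxP q.
have slD := slope_add af ak mxP qP ocK.
have slZ := slopeZ af ak qP.
(* Generators of the simplicial cone may lie outside [ocone]; the shift by the interior element [e]
   extends [sl] additively to all of [cc]. *)
pose sb d := sl (d + e) - sl e.
have sbD d d' : cc d -> cc d' -> sb (d + d') = sb d + sb d'.
  move=> hd hd'; have o1 := hd _ oe; have o2 := hd' _ oe.
  have E1 := slD _ _ o1 o2.
  have oE : oc (d + d' + e) by rewrite -addrA; exact: hd _ o2.
  have E2 := slD _ _ oE oe.
  have E3 : d + e + (d' + e) = d + d' + e + e by vring.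
  rewrite E3 E2 in E1; rewrite /sb; move: E1.
  move: (sl (d + d' + e)) (sl e) (sl (d + e)) (sl (d' + e)) => s1 s2 s3 s4; lra.
have sbZ (t : R) d : 0 <= t -> cc d -> sb (t *: d) = t * sb d.
  rewrite le_eqVlt => /orP[/eqP <- _|t0 hd].
    by rewrite scale0r mul0r /sb add0r subrr.
  have o1 := hd _ oe; have E1 := slZ _ _ t0 o1; have E0 := slZ _ _ t0 oe.
  have otd : oc (t *: d + e) by exact: (cconeZ af ak qP (ltW t0) hd oe).
  have ote := oconeZ af ak qP t0 oe.
  have E2 := slD _ _ otd ote; have E3 := slD _ _ (oconeZ af ak qP t0 o1) oe.
  have E4 : t *: d + e + t *: e = t *: (d + e) + e by vring.
  rewrite E4 E3 E1 E0 in E2; rewrite /sb; move: E2.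
  move: (sl (d + e)) (sl e) (sl (t *: d + e)) => s1 s2 s3 h.
  rewrite mulrBr; lra.
have [W [uW CW]] := ccone_simplicial af ak mxP qP ocK.
have ccW i : cc (row i W).
  rewrite CW; exists (delta_mx ord0 i); last by rewrite rowE.
  by move=> j; rewrite mxE ler0n.
have [a aE] := dotv_mulmx (fun i => sb (row i W)) uW.
exists a => c occ; have hc := ocone_ccone af ak qP occ.
have -> : sl c = sb c by rewrite /sb (slD _ _ occ oe) addrK.
have [lam l0 lE] : [set lam *m W | lam in [set lam : 'rV[R]_n | forall i, 0 <= lam ord0 i]] c.
  by rewrite -CW.
rewrite -lE aE mulmx_sum_row.
suff [_] : cc (\sum_i lam ord0 i *: row i W) /\
    sb (\sum_i lam ord0 i *: row i W) = \sum_i lam ord0 i * sb (row i W) by [].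
elim/big_rec2 : _ => [|i y1 y2 _ [h1 h2]].
  by split; [exact: ccone0|rewrite /sb add0r subrr].
have hi := cconeZ af ak qP (l0 i) (ccW i).
split; first exact: cconeD.
by rewrite (sbD _ _ hi h1) h2 (sbZ _ _ (l0 i) (ccW i)).
Qed.

(** The formula passes from [ocone] to [cc] by continuity of [f] on its support along
    [q + d + s *: e]. A positive exponent would keep [f] above [f q] on a whole ray, against
    integrability. *)
Lemma exponential_form : exists a : 'rV[R]_n, forall d, cc d ->
  f (q + d) = f q * expR (dotv a d) /\ dotv a d <= 0.
Proof.
have [a aE] := slope_linear; exists a.
have [e oe] := ocone_exists af ak mxP q.
have fq : 0 < f q by case: qP.
have fo c : oc c -> f (q + c) = f q * expR (dotv a c).
  move=> occ; have [K1 _] := occ; have fc := interior_supp_gt0 lf cf K1.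
  by rewrite -aE// /slope expRB !lnK ?posrE// mulrC divfK// gt_eqF.
have fcc d : cc d -> f (q + d) = f q * expR (dotv a d).
  move=> hd; apply/eqP/negPn/negP; rewrite -subr_eq0 => ne.
  pose eps := `|f (q + d) - f q * expR (dotv a d)| / 2.
  have eps0 : 0 < eps by rewrite divr_gt0// normr_gt0.
  have Kd : supp f (q + d) by rewrite (supp_ccone af ak mxP qP); exists d.
  have nf : \forall x \near q + d, supp f x -> `|f (q + d) - f x| < eps.
    have /subspace_continuousP/(_ _ Kd) H := cf.
    have nb : nbhs (f (q + d)) (ball (f (q + d)) eps) by exact: nbhsx_ballx.
    exact: H _ nb.
  have c1 : continuous (fun s : R => (q + d) + s *: e).
    move=> s; have h1 : u *: e @[u --> s] --> s *: e by exact: scalel_continuous.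
    exact: (cvgD (cvg_cst (q + d)) h1).
  have n1 : nbhs (0 : R) [set s | supp f ((q + d) + s *: e) ->
      `|f (q + d) - f ((q + d) + s *: e)| < eps].
    apply: (c1 0 [set x | supp f x -> `|f (q + d) - f x| < eps]).
    by rewrite scale0r addr0; exact: nf.
  have c2 : continuous (fun s : R => f q * expR (dotv a d + s * dotv a e)).
    move=> s; have h0 : (u : R) @[u --> s] --> s by exact: cvg_id.
    have h2 : dotv a d + u * dotv a e @[u --> s] --> dotv a d + s * dotv a e.
      exact: (cvgD (cvg_cst (dotv a d)) (cvgM h0 (cvg_cst (dotv a e)))).
    have ce := @continuous_expR R (dotv a d + s * dotv a e).
    have h3 : expR (dotv a d + u * dotv a e) @[u --> s] --> expR (dotv a d + s * dotv a e).
      exact: (cvg_comp (fun u => dotv a d + u * dotv a e) (@expR R) h2 ce).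
    exact: (cvgM (cvg_cst (f q)) h3).
  have n2 : nbhs (0 : R) [set s | `|f q * expR (dotv a d) -
      f q * expR (dotv a d + s * dotv a e)| < eps].
    have := c2 0; rewrite /continuous_at mul0r addr0 => h.
    exact: (h _ (nbhsx_ballx _ _ eps0)).
  have n12 : nbhs (0 : R) ([set s | supp f ((q + d) + s *: e) ->
      `|f (q + d) - f ((q + d) + s *: e)| < eps] `&` [set s | `|f q * expR (dotv a d) -
      f q * expR (dotv a d + s * dotv a e)| < eps]) by exact: filterI.
  have /nbhs_ballP[r /= r0 Hr] := n12.
  have s0 : 0 < r / 2 by rewrite divr_gt0.
  have [] := Hr (r / 2).
    by rewrite /ball /= sub0r normrN ger0_norm; lra.
  have oc1 : oc (d + (r / 2) *: e) by apply: hd; exact: (oconeZ af ak qP s0 oe).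
  have [K1 _] := oc1.
  rewrite /= -addrA => h1 h2.
  have {}h1 := h1 (interior_subset K1).
  rewrite (fo _ oc1) dotvDr dotvZr in h1.
  have : `|f (q + d) - f q * expR (dotv a d)| < eps + eps.
    apply: le_lt_trans (ltrD h1 h2); rewrite [X in _ <= _ + X]distrC.
    exact: ler_distD.
  by rewrite /eps -splitr ltxx.
move=> d hd; split; first exact: fcc.
rewrite leNgt; apply/negP => ad.
have d0 : d = 0.
  apply: (admissible_direction af fq) => N; exists N%:R; split; first by rewrite ger0_norm.
  rewrite (fcc _ (cconeZ af ak qP (ler0n R N) hd)) dotvZr ler_peMr ?(ltW fq)//.
  by rewrite -[leLHS]expR0 ler_expR mulr_ge0// ltW.
by move: ad; rewrite d0 -(scale0r (0 : 'rV[R]_n)) dotvZr mul0r ltxx.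
Qed.

End ExponentialForm.

(** * From maximizers to the equality conditions, and back *)

Lemma equality_structure (R : realType) (n : nat) (f g : 'rV[R]_n -> R) :
  admissible f -> admissible g ->
  (isqrt f (refl g) * iint (lc_sum f g) = (2 ^+ n)%:E * integral_Rn f * integral_Rn g)%E ->
  exists (C : set 'rV[R]_n) (v : 'rV[R]_n),
     simplicial_cone C /\
     supp f = supp (refl g) /\
     supp f = [set v + x | x in C] /\
     exists (c1 c2 : R) (a b : 'rV[R]_n),
       0 < c1 /\ 0 < c2 /\
       (forall x, supp f x -> f x = c1 * expR (- dotv a x)) /\
       (forall x, supp g x -> g x = c2 * expR (- dotv b x)) /\
       (forall x, C x -> 0 <= dotv a x /\ dotv b x <= 0).
Proof.
move=> af ag eqRS; have ak := admissible_refl ag; set k := refl g in ak eqRS *.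
have Hmax z : good f k z -> exists x y, x - y = 2 *: z /\ maximizer f k x y.
  by move=> [u [iu iv]]; exact: (exists_maximizer af ag eqRS iu iv).
have Hall z := Hmax z (all_good af ak Hmax z).
have Hpair z : exists p : 'rV[R]_n * 'rV[R]_n, p.1 - p.2 = 2 *: z /\ maximizer f k p.1 p.2.
  by have [x [y H]] := Hall z; exists (x, y).
have [p pP] := choice Hpair.
pose mx z := (p z).1; pose my z := (p z).2.
have mxP z : mx z - my z = 2 *: z /\ maximizer f k (mx z) (my z) by exact: pP.
have [q qP] : exists q, maximizer f k q q.
  have [x [y [xy mxy]]] := Hall 0; exists x.
  by move: xy mxy; rewrite scaler0 => /eqP; rewrite subr_eq0 => /eqP <-.
have mxP' := choice_sym mxP; have qP' := maximizer_sym qP.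
have KO v (h : interior (supp f) (q + v)) := interior_ocone af ak mxP qP h.
have LO v (h : interior (supp k) (q + v)) := interior_ocone ak af mxP' qP' h.
have LO' v : interior (supp k) (q + v) -> ocone f k q v by move=> /LO/ocone_sym.
have KO' v : interior (supp f) (q + v) -> ocone k f q v by move=> /KO/ocone_sym.
have Cf := supp_ccone af ak mxP qP.
have Ck := supp_ccone ak af mxP' qP'.
have CC : ccone f k q = ccone k f q by apply/seteqP; split=> d; exact: ccone_sym.
have [a aE] := exponential_form af ak mxP qP LO'.
have [b bE] := exponential_form ak af mxP' qP' KO'.
have [fq kq _] := qP.
exists (ccone f k q), q; split; first exact: (ccone_simplicial af ak mxP qP LO').
split; first by rewrite Cf Ck CC.
split; first exact: Cf.
(* The exponents of [f] and [k] in the offset [d] are non-positive on the cone. Passing from [d] to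
   [x] moves a factor into each constant; reflecting [k] back to [g] flips the sign of the exponent,
   so [a] is negated and [b] is not. *)
exists (f q * expR (- dotv a q)), (k q * expR (- dotv b q)), (- a), b.
split; first by rewrite mulr_gt0// expR_gt0.
split; first by rewrite mulr_gt0// expR_gt0.
split.
  move=> x; rewrite Cf => -[d hd <-].
  rewrite (aE d hd).1 dotvNl opprK dotvDr -mulrA -expRD; congr (_ * expR _); ring.
split.
  move=> x gx; have : supp k (- x) by apply/supp_refl; rewrite opprK.
  rewrite Ck => -[d hd dE].
  have -> : g x = k (- x) by rewrite /k /refl opprK.
  have -> : x = - (q + d) by rewrite dE opprK.
  by rewrite opprK (bE d hd).1 dotvNr opprK dotvDr -mulrA -expRD addKr.
move=> x hx; split; first by rewrite dotvNl oppr_ge0; exact: (aE x hx).2.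
by rewrite CC in hx; exact: (bE x hx).2.
Qed.

Lemma structure_equality (R : realType) (n : nat) (f g : 'rV[R]_n -> R)
    (C : set 'rV[R]_n) (v a b : 'rV[R]_n) (c1 c2 : R) :
  admissible f -> admissible g -> simplicial_cone C ->
  supp f = supp (refl g) -> supp f = [set v + x | x in C] ->
  (forall x, supp f x -> f x = c1 * expR (- dotv a x)) ->
  (forall x, supp g x -> g x = c2 * expR (- dotv b x)) ->
  (isqrt f (refl g) * iint (lc_sum f g) = (2 ^+ n)%:E * integral_Rn f * integral_Rn g)%E.
Proof.
move=> [lf If _ cf] [lg Ig _ cg] [W [uW CW]] fk fC fE gE.
apply: rogers_shephard_eq => //; [exact: mrow_lc|exact: mrow_lc|].
rewrite CW in fC.
apply: (simplicial_maximizer lf (log_concave_refl lg) uW fC (a := a) (b := b) (c1 := c1) (c2 := c2)).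
- by rewrite -fk fC.
- by rewrite -fC.
rewrite -fC fk => x /supp_refl gx.
by rewrite /refl gE// dotvNr opprK.
Qed.

Theorem theorem2p6 (R : realType) (n : nat) (f g : 'rV[R]_n -> R) :
  log_concave f -> log_concave g ->
  (integral_Rn f < +oo)%E -> (integral_Rn g < +oo)%E ->
  interior (supp f) !=set0 -> interior (supp g) !=set0 ->
  {within supp f, continuous f} -> {within supp g, continuous g} ->
  (integral_Rn (fun x => Num.sqrt (f x * refl g x)) * iint (lc_sum f g)
     <= (2 ^+ n)%:E * integral_Rn f * integral_Rn g)%E /\
  ((integral_Rn (fun x => Num.sqrt (f x * refl g x)) * iint (lc_sum f g)
     = (2 ^+ n)%:E * integral_Rn f * integral_Rn g)%E <->
   exists (C : set 'rV[R]_n) (v : 'rV[R]_n),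
     simplicial_cone C /\
     supp f = supp (refl g) /\
     supp f = [set v + x | x in C] /\
     exists (c1 c2 : R) (a b : 'rV[R]_n),
       0 < c1 /\ 0 < c2 /\
       (forall x, supp f x -> f x = c1 * expR (- dotv a x)) /\
       (forall x, supp g x -> g x = c2 * expR (- dotv b x)) /\
       (forall x, C x -> 0 <= dotv a x /\ dotv b x <= 0)).
Proof.
move=> lf lg If Ig Kf Kg cf cg.
have af : admissible f by split.
have ag : admissible g by split.
split; first by apply: rogers_shephard_le => //; exact: mrow_lc.
split; first exact: equality_structure.
move=> [C [v [sC [fk [fC [c1 [c2 [a [b [_ [_ [fE [gE _]]]]]]]]]]]]].
exact: structure_equality sC fk fC fE gE.
Qed.
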